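(* Let $n\ge2$, $\alpha,\beta,u,v\in\mathbb R^n$, and $h_\varepsilon=P_{\alpha+\varepsilon u}\boxplus_nP_{\beta+\varepsilon v}$ for real $\varepsilon$. Write $h_0(x)=\prod_{\ell=1}^\kappa(x-c_\ell)^{r_\ell}$ with $c_1<\cdots<c_\kappa$, $\sum_\ell r_\ell=n$, and let $Q_\ell$ be the degree-$r_\ell$ tangent polynomial of the cluster $c_\ell$ (defined in the context). Suppose each $Q_\ell$ has simple roots, and put $$M=\sum_{\ell=1}^\kappa r_\ell(r_\ell-1),\qquad D_*=\prod_{\ell=1}^\kappa\operatorname{Disc}(Q_\ell)\prod_{\ell<j}|c_\ell-c_j|^{2r_\ell r_j},\qquad \theta=\frac{M}{n(n-1)}.$$ Then, as $\varepsilon\to0$, $$\chi_n[h_\varepsilon]=\theta\log|\varepsilon|+\frac{\log D_*}{n(n-1)}+O(|\varepsilon|),\qquad \mathcal N_n(h_\varepsilon)=|\varepsilon|^{2\theta}D_*^{2/[n(n-1)]}\bigl(1+O(|\varepsilon|)\bigr).$$ Both $\chi_n[h_\varepsilon]-\theta\log|\varepsilon|$ and $|\varepsilon|^{-2\theta}\mathcal N_n(h_\varepsilon)$ extend real analytically through $\varepsilon=0$. The entropy's constant term may equivalently be written $$\frac{\log D_*}{n(n-1)}=\sum_{r_\ell\ge2}\frac{r_\ell(r_\ell-1)}{n(n-1)}\chi_{r_\ell}[Q_\ell]+\frac{2}{n(n-1)}\sum_{\ell<j}r_\ell r_j\log|c_\ell-c_j|.$$ Moreover, $\varepsilon^2\Phi_n(h_\varepsilon)$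 extends real analytically through $\varepsilon=0$, with value there $$K=\frac{4}{n(n-1)^2}\sum_{\ell=1}^\kappa\|s(\lambda_\ell)\|_2^2=\sum_{r_\ell\ge2}\frac{r_\ell(r_\ell-1)^2}{n(n-1)^2}\Phi_{r_\ell}(Q_\ell),$$ where $\lambda_\ell$ is the root vector of $Q_\ell$ and the score of a singleton is the zero vector. If at least one root of $h_0$ is repeated, then $K>0$, $\Phi_n(h_\varepsilon)=K\varepsilon^{-2}+O(|\varepsilon|^{-1})$, and $\Phi_n(h_\varepsilon)^{-1}=K^{-1}\varepsilon^2+O(|\varepsilon|^3)$.
   Context: $P_\alpha(x)=\prod_{i=1}^n(x-\alpha_i)$. Finite free additive convolution in degree $d\ge1$: for $p(x)=\sum_{k=0}^d(-1)^ka_kx^{d-k}$ and $q(x)=\sum_{k=0}^d(-1)^kb_kx^{d-k}$ with $a_0=b_0=1$, set $(p\boxplus_d q)(x)=\sum_{k=0}^d(-1)^kc_kx^{d-k}$ with $c_k=\sum_{i+j=k}\frac{(d-i)!(d-j)!}{d!(d-k)!}a_ib_j$. It preserves real-rootedness (Walsh). For a vector $\rho\in\mathbb R^d$ ($d\ge2$) with distinct coordinates: score $s(\rho)_i=\sum_{j\ne i}\frac1{\rho_i-\rho_j}$; Fisher information $\Phi_d(P_\rho)=\frac4{d(d-1)^2}\|s(\rho)\|_2^2$; entropy $\chi_d[P_\rho]=\frac2{d(d-1)}\sum_{i<j}\log|\rho_i-\rho_j|$; entropy power $\mathcal N_d(P_\rho)=e^{2\chi_d[P_\rho]}$. At repeated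 roots $\Phi_d=+\infty$, $\chi_d=-\infty$. Tangent polynomials. If $r_\ell\ge2$, by Fujie's atom theorem there is a unique pair $(a,b)$, with $a$ a root of $P_\alpha$ of multiplicity $m$ and $b$ a root of $P_\beta$ of multiplicity $k$, such that $a+b=c_\ell$ and $m+k-n=r_\ell$. With $I=\{i:\alpha_i=a\}$, $J=\{j:\beta_j=b\}$, $U(z)=\prod_{i\in I}(z-u_i)$, $V(z)=\prod_{j\in J}(z-v_j)$, $r=r_\ell$, put $Q_\ell=\left(\frac{r!}{m!}U^{(m-r)}\right)\boxplus_r\left(\frac{r!}{k!}V^{(k-r)}\right)$. If $r_\ell=1$, put $Q_\ell(z)=z-\lambda_\ell$ with $\lambda_\ell=-\partial_\varepsilon h_\varepsilon(c_\ell)|_{\varepsilon=0}/h_0'(c_\ell)$, and $\operatorname{Disc}(Q_\ell)=1$. In general $\operatorname{Disc}$ of a monic polynomial is the product of squared differences of its roots over unordered pairs. *)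

(* Defs.v *)
From HB Require Import structures.
From mathcomp Require Import all_boot all_order all_algebra.
From mathcomp Require Export separable.
From mathcomp Require Import all_classical all_reals all_analysis.
Set Implicit Arguments.
Unset Strict Implicit.
Unset Printing Implicit Defensive.
Import Order.TTheory GRing.Theory Num.Theory.
Import numFieldNormedType.Exports.
Local Open Scope classical_set_scope.
Local Open Scope ring_scope.

(* P_rho(x) = \prod_i (x - rho_i) *)
Definition root_poly (R : realType) (d : nat) (rho : 'rV[R]_d) : {poly R} :=
  \prod_(i < d) ('X - (rho 0 i)%:P).

(* In p(x) = \sum_k (-1)^k a_k x^(d-k), the coefficient a_k. *)
Definition scoef (R : realType) (d : nat) (p : {poly R}) (k : nat) : R :=
  (-1) ^+ k * p`_(d - k).

Definition fconv (R : realType) (d : nat) (p q : {poly R}) : {poly R} :=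
  \sum_(k < d.+1)
    ((-1) ^+ k *
     \sum_(i < k.+1)
        ((d - i)`! * (d - (k - i))`!)%:R / (d`! * (d - k)`!)%:R
        * scoef d p i * scoef d q (k - i)) *: 'X^(d - k).

(* The vector of the roots of a monic real-rooted p of degree d. It is only
   determined up to a permutation of the coordinates, under which all the
   quantities defined from it below are invariant; it is 0 if there is none. *)
Definition root_vec (R : realType) (d : nat) (p : {poly R}) : 'rV[R]_d :=
  xget 0 [set rho : 'rV[R]_d | p = root_poly rho].

(* The empty sum makes the score of a singleton the zero vector. *)
Definition score (R : realType) (d : nat) (rho : 'rV[R]_d) : 'rV[R]_d :=
  \row_(i < d) \sum_(j < d | j != i) (rho 0 i - rho 0 j)^-1.

(* Squared Euclidean norm; the library norm on 'rV[R]_d is the sup norm. *)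
Definition sqnorm2 (R : realType) (d : nat) (x : 'rV[R]_d) : R :=
  \sum_(i < d) x 0 i ^+ 2.

Definition fisher (R : realType) (d : nat) (p : {poly R}) : \bar R :=
  let rho := root_vec d p in
  if injectiveb (rho 0)
  then (4 / (d%:R * (d%:R - 1) ^+ 2) * sqnorm2 (score rho))%:E
  else +oo%E.

Definition entropy (R : realType) (d : nat) (p : {poly R}) : \bar R :=
  let rho := root_vec d p in
  if injectiveb (rho 0)
  then (2 / (d%:R * (d%:R - 1))
        * \sum_(i < d) \sum_(j < d | (i < j)%N) ln `|rho 0 i - rho 0 j|)%:E
  else -oo%E.

Definition entropy_power (R : realType) (d : nat) (p : {poly R}) : \bar R :=
  expeR (2%:E * entropy d p)%E.

Definition disc (R : realType) (d : nat) (p : {poly R}) : R :=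
  let rho := root_vec d p in
  \prod_(i < d) \prod_(j < d | (i < j)%N) (rho 0 i - rho 0 j) ^+ 2.

Definition h_poly (R : realType) (n : nat) (alpha beta u v : 'rV[R]_n) (e : R)
    : {poly R} :=
  fconv n (root_poly (alpha + e *: u)) (root_poly (beta + e *: v)).

(* #|index_set alpha a| is the multiplicity of a as a root of P_alpha. *)
Definition index_set (R : realType) (n : nat) (alpha : 'rV[R]_n) (a : R)
    : {set 'I_n} :=
  [set i | alpha 0 i == a].

(* r!/m! U^(m-r), where U(z) = \prod_(i in I) (z - u_i) and m = #|I| *)
Definition reduced_poly (R : realType) (n : nat) (I : {set 'I_n})
    (u : 'rV[R]_n) (r : nat) : {poly R} :=
  (r`!%:R / (#|I|)`!%:R) *: (\prod_(i in I) ('X - (u 0 i)%:P))^`(#|I| - r).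

(* The tangent polynomial at a root c of multiplicity r of h_0. For r >= 2 the
   pair (a, b) is given by indices (i, j) with a = alpha_i and b = beta_j; the
   condition m + k - n = r is written m + k = n + r. The pair (a, b) is unique,
   and it exists by Fujie's theorem, so the default value 0 is never used at an
   actual root. *)
Definition tangent_poly (R : realType) (n : nat) (alpha beta u v : 'rV[R]_n)
    (c : R) (r : nat) : {poly R} :=
  if r == 1%N then
    'X - (- derive1 (fun e : R => (h_poly alpha beta u v e).[c]) 0
          / (deriv (h_poly alpha beta u v 0)).[c])%:P
  else
    if [pick ij : 'I_n * 'I_n |
          (alpha 0 ij.1 + beta 0 ij.2 == c) &&
          (#|index_set alpha (alpha 0%R ij.1)|
           + #|index_set beta (beta 0%R ij.2)| == n + r)%N] is Some ij
    then fconv r (reduced_poly (index_set alpha (alpha 0 ij.1)) u r)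
                 (reduced_poly (index_set beta (beta 0 ij.2)) v r)
    else 0.

Definition analytic_at (R : realType) (f : R -> R) (x : R) : Prop :=
  exists a : R^nat, \forall y \near x, pseries a (y - x) @ \oo --> f y.

(* F is a real analytic extension through 0 of f, which may be anything at 0
   but is finite and agrees with F at every nonzero e close to 0. *)
Definition analytic_extension0 (R : realType) (f : R -> \bar R) (F : R -> R)
    : Prop :=
  analytic_at F 0 /\ \forall e \near 0^', f e = (F e)%:E.

(* Main.v *)
Require Import Defs.
From HB Require Import structures.
From mathcomp Require Import all_boot all_order all_algebra.
From mathcomp Require Import ring lra zify complex.
From mathcomp Require Import all_classical all_reals all_analysis.
Import Order.TTheory GRing.Theory Num.Theory.
Import numFieldNormedType.Exports.
Set Implicit Arguments.
Unset Strict Implicit.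
Unset Printing Implicit Defensive.
Local Open Scope classical_set_scope.
Local Open Scope ring_scope.

(* At a root c of h_0 of multiplicity r, the zoom x = c + e z turns e^-r h_e(x) into a polynomial
   in z whose coefficients are polynomial in e and whose value at e = 0 is a nonzero constant
   times Q(z). For r >= 2 this follows from the
   behaviour of the convolution under translation and dilation, since P_alpha(a + e z) is
   e^m U(z) times a factor that tends to a constant. Existence of the pair (a, b) is not an issue:
   otherwise tangent_poly is 0, which is not separable. Each Q is real-rooted (Walsh, proved from
   Laguerre's theorem on polar derivatives and the Gauss-Lucas theorem), hence has r simple real
   roots, and sign changes give n distinct real roots c_l + e z with z close to a root of Q_l.

   Analyticity does not require analytic roots: Disc(h_e) and Disc(h_e)^2 |s|^2 are symmetric in
   the roots, hence polynomials in e (a determinant and a trace built from the companion matrix).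
   The limits of the roots determine the order of vanishing of these polynomials and their leading
   coefficients, so that all the quantities of interest are ln G, G^a or N/G^2 with G, N
   polynomials and G(0) > 0. These solve a linear ODE with polynomial coefficients, whose power
   series solution converges. *)

(** * Grace's theorem for half-planes *)

(** Walsh's theorem comes from an apolar pairing: d! times (p boxplus q)(z) pairs p with q(X + z).
    For Im z > 0 the linear factors of q(X + z) act on p as polar derivatives with poles in the
    upper half-plane, and none of these creates a root there. The score at a simple root is p''/(2
    p'), so the squared product of the p'(x_i) clears the denominators of |s|^2 symmetrically. The
    roots of h_e are controlled by limits only, with no rate. This suffices because a polynomial
    P(e) for which P(e)/e^m converges is divisible by X^m. The closed forms in G and N make sense at
    e = 0 too and furnish the extensions there, even where the entropy of h_0 is infinite. *)

Lemma horner_deriv_prod_XsubC (F : fieldType) (s : seq F) z :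
  (forall x, x \in s -> z != x) ->
  (\prod_(x <- s) ('X - x%:P))^`().[z]
  = (\prod_(x <- s) ('X - x%:P)).[z] * \sum_(x <- s) (z - x)^-1.
Proof.
elim: s => [|y s IH] sz; first by rewrite !big_nil derivC horner0 mulr0.
rewrite !big_cons derivM derivXsubC mul1r hornerD !hornerM IH; last first.
  by move=> x xs; apply: sz; rewrite inE xs orbT.
have zy : z - y != 0 by rewrite subr_eq0 sz// inE eqxx.
rewrite hornerXsubC mulrDr mulrAC mulrA; congr (_ + _).
by rewrite mulfV// mul1r.
Qed.

Section Grace.
Variable C : numClosedFieldType.
Implicit Types (p q g : {poly C}) (w x z : C).

Definition upper_free p := forall z, 0 < 'Im z -> ~~ root p z.

(** Laguerre's polar derivative with pole w; the degree d is an explicit argument, not read off from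
    p. *)
Definition polar (d : nat) w p : {poly C} := p *+ d - ('X - w%:P) * p^`().

(** Up to a global sign and normalisation, the classical apolarity form of p and g(-X): hence the
    absence of alternating signs. *)
Definition apolar (d : nat) p g : C :=
  \sum_(k < d.+1) (k`! * (d - k)`!)%:R * p`_k * g`_(d - k).

Lemma Im_inv z : 'Im z^-1 = - 'Im z * `|z^-1| ^+ 2.
Proof.
have -> : `|z^-1| ^+ 2 = `|z| ^- 2 by rewrite normfV exprVn.
rewrite invC_norm ImMl; last by rewrite realV rpredX// normr_real.
by rewrite Im_conj mulrC.
Qed.

Lemma coef_polar d w p k :
  (polar d w p)`_k = p`_k *+ d - p`_k *+ k + w * (p`_k.+1 *+ k.+1).
Proof.
rewrite /polar coefB mulrBl coefB coefMn coefXM coefCM opprB (coef_deriv p k).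
have -> : (if k == 0%N then 0 else p^`()`_k.-1) = p`_k *+ k.
  by case: k => [|k]; rewrite ?mulr0n// coef_deriv.
by rewrite addrA addrAC.
Qed.

Lemma sumr_const_seq (T : Type) (s : seq T) (a : C) :
  \sum_(x <- s) a = a *+ size s.
Proof. by rewrite big_const_seq count_predT iter_addr_0. Qed.

(** The elements of [s] are the 1/(z - x) for the roots x of p. Since Im x <= 0, each satisfies Im y
    <= - Im z |y|^2, which describes the disc onto which inversion about z maps the closed lower
    half-plane. The sum of these inequalities is all that Gauss-Lucas and Laguerre require. *)
Lemma log_deriv_upper p z : upper_free p -> 0 < 'Im z ->
  exists s : seq C, [/\ size s = (size p).-1, 0 \notin s,
    p^`().[z] = p.[z] * \sum_(y <- s) y &
    'Im (\sum_(y <- s) y) <= - 'Im z * \sum_(y <- s) `|y| ^+ 2].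
Proof.
move=> up z0; have [s ps] := closed_field_poly_normal p.
have [->|p0] := eqVneq p 0.
  by exists [::]; rewrite !big_nil deriv0 !horner0 mul0r mulr0 raddf0 size_poly0.
have lp0 : lead_coef p != 0 by rewrite lead_coef_eq0.
have sIm x : x \in s -> 'Im x <= 0.
  move=> xs; rewrite real_leNgt ?Creal_Im ?real0//; apply/negP => /up.
  by rewrite ps rootZ// root_prod_XsubC xs.
have sz x : x \in s -> z != x.
  by move=> /sIm xs; apply: contraTneq z0 => ->; rewrite -real_leNgt ?Creal_Im ?real0.
exists [seq (z - x)^-1 | x <- s]; rewrite size_map !big_map; split.
- by rewrite ps size_scale// size_prod_XsubC.
- apply/negP => /mapP[x /sz + /esym/eqP].
  by rewrite invr_eq0 subr_eq0 => /negPf ->.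
- rewrite ps derivZ !hornerZ -mulrA; congr (_ * _).
  exact: horner_deriv_prod_XsubC.
- rewrite raddf_sum/= mulr_sumr !big_seq; apply: ler_sum => x xs.
  rewrite Im_inv ler_wpM2r ?exprn_ge0// lerN2 raddfB/= lerDl oppr_ge0.
  exact: sIm.
Qed.

Lemma gauss_lucas_upper_free p : (1 < size p)%N -> upper_free p -> upper_free p^`().
Proof.
move=> sp up z z0; have [s [ss s0 dp ImS]] := log_deriv_upper up z0.
have pz0 : p.[z] != 0 by have := up z z0.
rewrite /root dp mulf_eq0 negb_or pz0 andTb; apply: contraTneq ImS => S0.
rewrite S0 raddf0 -real_ltNge ?real0 ?realM ?realN ?Creal_Im ?rpred_sum//; last first.
  by move=> x _; rewrite rpredX// normr_real.
rewrite mulNr oppr_lt0 pmulr_rgt0//.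
case: s ss s0 {dp S0} => [|y s _]; first by case: (size p) sp => [|[]].
rewrite inE negb_or eq_sym => /andP[y0 _].
rewrite big_cons ltr_pwDl ?exprn_gt0 ?normr_gt0//.
by apply: sumr_ge0 => x _; rewrite exprn_ge0.
Qed.

(** Laguerre's theorem. The coefficient of degree d of the polar derivative is the leading
    coefficient of p times (d+1) w minus the sum of the roots. It cannot vanish, since that sum has
    nonpositive imaginary part and w a positive one. A root z of the polar derivative would make
    1/(z - w) the mean of [s], which forces Im w <= 0. *)
Lemma polar_upper_free d w p : size p = d.+2 -> upper_free p -> 0 < 'Im w ->
  size (polar d.+1 w p) = d.+1 /\ upper_free (polar d.+1 w p).
Proof.
move=> sp up w0.
have p0 : p != 0 by rewrite -size_poly_eq0 sp.
have lp0 : lead_coef p != 0 by rewrite lead_coef_eq0.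
split.
  have [s ps] := closed_field_poly_normal p.
  have ss : size s = d.+1.
    by move: sp; rewrite ps size_scale// size_prod_XsubC => -[].
  have Sle0 : 'Im (\sum_(x <- s) x) <= 0.
    rewrite raddf_sum big_seq sumr_le0// => x xs.
    rewrite real_leNgt ?Creal_Im ?real0//; apply/negP => /up.
    by rewrite ps rootZ// root_prod_XsubC xs.
  have pd1 : p`_d.+1 = lead_coef p by rewrite lead_coefE sp.
  have pd : p`_d = - (lead_coef p * \sum_(x <- s) x).
    have sn0 : size s != 0 by rewrite ss.
    have := coefPn_prod_XsubC sn0; rewrite ss/= => H.
    by rewrite {1}ps coefZ H mulrN.
  apply/eqP; rewrite eqn_leq; apply/andP; split.
    apply/leq_sizeP => j dj; rewrite coef_polar [p`_j.+1]nth_default ?sp//.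
    rewrite mul0rn mulr0 addr0; move: dj; rewrite leq_eqVlt => /predU1P[<-|dj].
      by rewrite subrr.
    by rewrite nth_default ?sp// !mul0rn subrr.
  rewrite ltnNge; apply/negP => /leq_sizeP /(_ d (leqnn _)).
  rewrite coef_polar// mulrS addrK pd pd1 addrC.
  rewrite mulrnAr [w * _]mulrC -mulrnAr -mulrBr.
  move/eqP; rewrite mulf_eq0 (negPf lp0)/= => /eqP H.
  have : 'Im (w *+ d.+1 - \sum_(x <- s) x) = 0 by rewrite H raddf0.
  rewrite raddfB raddfMn/= => /eqP; apply/negP; rewrite gt_eqF// subr_gt0.
  by apply: le_lt_trans Sle0 _; rewrite pmulrn_lgt0.
move=> z z0; apply/negP => /rootP.
have [s [ss s0 dp ImS]] := log_deriv_upper up z0.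
rewrite sp/= in ss; set S := \sum_(x <- s) x in dp ImS *.
have pz0 : p.[z] != 0 by have := up z z0.
rewrite /polar hornerD hornerN hornerMn hornerM hornerXsubC dp.
rewrite -mulr_natr mulrCA -mulrBr => /eqP; rewrite mulf_eq0 (negPf pz0)/= subr_eq0.
move/eqP => HS.
have d0 : 0 < d.+1%:R :> C by rewrite ltr0n.
have zw0 : z - w != 0.
  by apply/eqP => H; move: HS; rewrite H mul0r => /eqP; rewrite gt_eqF.
set y := (z - w)^-1.
have So : S = d.+1%:R * y by rewrite HS mulrC mulKf.
(* y is the mean of s, and the disc t |y|^2 + Im y <= 0 is convex. *)
have var : d.+1%:R * `|y| ^+ 2 <= \sum_(x <- s) `|x| ^+ 2.
  have : 0 <= \sum_(x <- s) `|x - y| ^+ 2.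
    by apply: sumr_ge0 => x _; rewrite exprn_ge0.
  have -> : \sum_(x <- s) `|x - y| ^+ 2 =
     \sum_(x <- s) `|x| ^+ 2 - S * y^* - S^* * y + d.+1%:R * `|y| ^+ 2.
    rewrite /S rmorph_sum/= !mulr_suml -!sumrB.
    rewrite mulr_natl -ss -sumr_const_seq -big_split/=.
    by apply: eq_bigr => x _; rewrite !normCK rmorphB/=; ring.
  rewrite So rmorphM/= conjC_nat -!mulrA -normCK [y^* * y]mulrC -normCK => H.
  by rewrite -subr_ge0; move: H; rewrite subrK.
have oz0 : 0 < `|y| ^+ 2 by rewrite exprn_gt0// normr_gt0 invr_eq0.
have : 'Im S <= - 'Im z * (d.+1%:R * `|y| ^+ 2).
  by apply: le_trans ImS _; rewrite !mulNr lerN2 ler_pM2l.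
rewrite So ImMl ?Im_inv ?realn// mulrCA ler_pM2r ?(mulr_gt0 d0 oz0)//.
rewrite lerN2 raddfB/= lerBrDl gerDr real_leNgt ?Creal_Im ?real0//.
by rewrite w0.
Qed.

(** Multiplication of g by X + w is adjoint to the polar derivative of p with pole w, so a linear
    factor can be traded for one degree. *)
Lemma apolar_mulXDC d p g w : (size g <= d.+1)%N ->
  apolar d.+1 p (('X + w%:P) * g) = apolar d (polar d.+1 w p) g.
Proof.
move=> sg; rewrite /apolar.
under eq_bigr do rewrite mulrDl coefD coefXM coefCM mulrDr.
rewrite big_split/= big_ord_recr/= subnn eqxx mulr0 addr0.
rewrite [X in _ + X]big_ord_recl/= subn0 (nth_default _ sg) !mulr0 add0r.
rewrite -big_split; apply: eq_bigr => k _; rewrite /bump leq0n add1n.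
have := ltn_ord k; rewrite ltnS; move: (nat_of_ord k) => {}k kd.
rewrite subSS subSn//.
rewrite coef_polar [(_.+1 == 0%N)]/= -pred_Sn.
rewrite !factS !natrM -!(mulr_natr p`_k) -(mulr_natr p`_k.+1) [d.+1%:R]mulrS [k.+1%:R]mulrS.
rewrite [(d - k).+1%:R]mulrS [(d - k)%:R]natrB//.
move: (k`!%:R : C) ((d - k)`!%:R : C) => a b.
rewrite /=; ring.
Qed.

(** Grace's theorem for a half-plane. Each traded factor leaves a polynomial of degree one less that
    is still free of roots in the upper half-plane; what remains at the end is a nonzero
    constant. *)
Theorem apolar_neq0 d p ws : size p = d.+1 -> upper_free p -> size ws = d ->
  (forall w, w \in ws -> 0 < 'Im w) ->
  apolar d p (\prod_(w <- ws) ('X + w%:P)) != 0.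
Proof.
elim: ws d p => [|w ws IH] d p sp up /= sws ImW.
  rewrite -sws /apolar big_ord_recl big_ord0 big_nil/= subnn coef1 eqxx.
  rewrite addr0 mulr1 mul1r.
  have : lead_coef p != 0 by rewrite lead_coef_eq0 -size_poly_eq0 sp.
  by rewrite lead_coefE sp -sws.
case: d sp sws => [//|d] sp [sws].
have [sp' up'] := polar_upper_free sp up (ImW w (mem_head _ _)).
rewrite big_cons apolar_mulXDC ?IH//.
  by move=> x xs; apply: ImW; rewrite inE xs orbT.
have -> : \prod_(j <- ws) ('X + j%:P) = \prod_(j <- [seq - x | x <- ws]) ('X - j%:P).
  by rewrite big_map; apply: eq_bigr => i _; rewrite polyCN opprK.
by rewrite size_prod_XsubC size_map sws.
Qed.
End Grace.

(** * Real-rootedness of the convolution *)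

Section RealRooted.
Variable R : realType.
Implicit Types p q : {poly R}.

(** The zero polynomial splits in this sense, so that [splits_deriv] has no exception. *)
Definition splits p := exists s : seq R, p = lead_coef p *: \prod_(x <- s) ('X - x%:P).

Local Notation toC := (real_complex R).

Lemma splits_upper_free p : p != 0 -> splits p -> upper_free (map_poly toC p).
Proof.
move=> p0 [s ->] z z0.
rewrite map_polyZ/= rootZ ?fmorph_eq0 ?lead_coef_eq0//.
have -> : map_poly toC (\prod_(x <- s) ('X - x%:P)) =
    \prod_(x <- [seq toC x | x <- s]) ('X - x%:P).
  by rewrite rmorph_prod big_map; apply: eq_bigr => x _; rewrite /= map_polyXsubC.
rewrite root_prod_XsubC; apply: contraTN z0 => /mapP[x _ ->].
by rewrite -complexIm/= ltxx.
Qed.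

(** The roots of a real polynomial are stable under conjugation, so excluding the upper half-plane
    excludes the lower one as well. *)
Lemma upper_free_splits p : upper_free (map_poly toC p) -> splits p.
Proof.
move=> up; have [->|p0] := eqVneq p 0.
  by exists [::]; rewrite lead_coef0 scale0r.
have [s ps] := closed_field_poly_normal (map_poly toC p).
have lp0 : lead_coef (map_poly toC p) != 0 by rewrite lead_coef_eq0 map_poly_eq0.
have rs x : x \in s -> toC (complex.Re x) = x.
  move=> xs.
  have rx : root (map_poly toC p) x by rewrite ps rootZ// root_prod_XsubC.
  have rxc : root (map_poly toC p) x^*.
    have <- : map_poly Num.conj (map_poly toC p) = map_poly toC p.
      rewrite -map_poly_comp; apply: eq_map_poly => a.
      by apply: conj_Creal; rewrite complex_real.
    exact: rmorph_root.
  have h1 : ~~ (0 < 'Im x) by apply/negP => /up; rewrite rx.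
  have h2 : ~~ (0 < 'Im x^*) by apply/negP => /up; rewrite rxc.
  rewrite -real_leNgt ?Creal_Im ?real0// in h1.
  rewrite -real_leNgt ?Creal_Im ?real0// Im_conj oppr_le0 in h2.
  have h : 'Im x = 0 by apply/eqP; rewrite eq_le h1 h2.
  by apply: RRe_real; apply/Creal_ImP.
exists [seq complex.Re x | x <- s]; apply: (map_poly_inj toC).
rewrite map_polyZ/= {1}ps lead_coef_map rmorph_prod/= big_map; congr (_ *: _).
by rewrite !big_seq; apply: eq_bigr => x /rs xs; rewrite map_polyXsubC/= xs.
Qed.


Lemma splits_deriv p : splits p -> splits p^`().
Proof.
move=> sp; have [p1|p1] := leqP (size p) 1.
  exists [::]; rewrite [p]size1_polyC// derivC lead_coef0 scale0r//.
apply: upper_free_splits; rewrite -deriv_map; apply: gauss_lucas_upper_free.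
  by rewrite size_map_poly.
apply: splits_upper_free => //.
by apply: contraTneq p1 => ->; rewrite size_poly0.
Qed.

Lemma splits_derivn p k : splits p -> splits p^`(k).
Proof. by move=> sp; elim: k => // k IH; rewrite derivnS; apply: splits_deriv. Qed.

Lemma splitsZ a p : splits p -> splits (a *: p).
Proof. by move=> [s ps]; exists s; rewrite lead_coefZ -scalerA -ps. Qed.

Lemma coef_fconv d p q t : (fconv d p q)`_t =
  if (t <= d)%N then
    \sum_(i < (d - t).+1) ((d - i)`! * (t + i)`!)%:R / (d`! * t`!)%:R * p`_(d - i) * q`_(t + i)
  else 0.
Proof.
rewrite /fconv coef_sum; have [td|dt] := leqP t d; last first.
  apply: big1 => k _; rewrite coefZ coefXn gtn_eqF ?mulr0//.
  by apply: leq_ltn_trans dt; exact: leq_subr.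
have kd : (d - t < d.+1)%N by rewrite ltnS leq_subr.
rewrite (bigD1 (Ordinal kd))//= [X in _ + X]big1 ?addr0; last first.
  move=> k; rewrite -val_eqE/= => nk; rewrite coefZ coefXn; case: eqP; rewrite ?mulr0// => tk.
  by have := ltn_ord k; move: nk; rewrite tk ltnS => + kd'; rewrite subKn// eqxx.
rewrite coefZ coefXn subKn// eqxx mulr1 mulr_sumr; apply: eq_bigr => i _.
have id : (i <= d - t)%N by rewrite -ltnS.
rewrite /scoef.
have -> : (d - (d - t - i))%N = (t + i)%N.
  by rewrite -subnDA subKn// -leq_subRL.
have -> : (-1) ^+ (d - t) = (-1) ^+ (d - t - i) * (-1) ^+ i :> R.
  by rewrite -exprD subnK.
have s1 k : (-1) ^+ k * (-1) ^+ k = 1 :> R by rewrite -exprMn mulrNN mulr1 expr1n.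
move: (_ / _) (s1 i) (s1 (d - t - i)%N) => c; move: (_ ^+ _) (_ ^+ _) => x y xx yy.
transitivity ((x * x) * (y * y) * (c * p`_(d - i) * q`_(t + i))); first by ring.
by rewrite xx yy !mul1r.
Qed.

Lemma nderivn_factE p k : p^`(k) = k`!%:R *: p^`N(k).
Proof. by rewrite nderivn_def scaler_nat. Qed.

(** In this form p acts on q as a differential operator with constant coefficients, which makes
    commutation with translations immediate. *)
Lemma fconvE d p q : (size p <= d.+1)%N -> (size q <= d.+1)%N ->
  fconv d p q = \sum_(i < d.+1) (i`!%:R / d`!%:R * p`_i) *: q^`(d - i).
Proof.
move=> sp sq; apply/polyP => t; rewrite coef_fconv coef_sum.
rewrite [RHS](reindex_inj rev_ord_inj)/=; case: leqP => td; last first.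
  apply/esym/big1 => i _; rewrite coefZ coef_derivn [q`__]nth_default ?mul0rn ?mulr0//.
  by apply: leq_trans sq _; apply: leq_trans td _; rewrite leq_addl.
have kd : ((d - t).+1 <= d.+1)%N by rewrite ltnS leq_subr.
rewrite (big_ord_widen _ (fun i => ((d - i)`! * (t + i)`!)%:R / (d`! * t`!)%:R * p`_(d - i) * q`_(t + i)) kd).
rewrite big_mkcond; apply: eq_bigr => -[i /= id] _; rewrite subSS subKn//.
rewrite coefZ coef_derivn addnC; case: ltnP => ti; last first.
  rewrite [q`__]nth_default ?mul0rn ?mulr0//.
  by apply: leq_trans sq _; lia.
rewrite -mulr_natr -(ffact_fact (leq_addr t i)) addKn !natrM.
have ? : d`!%:R != 0 :> R by rewrite pnatr_eq0 -lt0n fact_gt0.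
have ? : t`!%:R != 0 :> R by rewrite pnatr_eq0 -lt0n fact_gt0.
by field; apply/andP.
Qed.

Lemma coef_comp_polyXDC (K : comNzRingType) (q : {poly K}) x m :
  (q \Po ('X + x%:P))`_m = (q^`N(m)).[x].
Proof.
rewrite addrC /comp_poly (nderiv_taylor (map_poly polyC q) (mulrC _ _)).
rewrite size_map_polyC coef_sum.
under eq_bigr => i _ do rewrite nderivn_map horner_map coefCM coefXn.
have [mq|mq] := ltnP m (size q).
  rewrite (bigD1 (Ordinal mq))//= eqxx mulr1 big1 ?addr0// => i.
  by rewrite -val_eqE/= eq_sym => /negPf ->; rewrite mulr0.
rewrite nderivn_poly0// horner0 big1// => i _.
by rewrite gtn_eqF ?mulr0// (leq_trans (ltn_ord i)).
Qed.

(** By Taylor's formula the coefficient of degree d - i of q(X + x) is q^(d-i)(x)/(d-i)!, which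
    turns [fconvE] at x into the pairing. *)
Lemma fconv_apolar (C : numClosedFieldType) (f : {rmorphism R -> C}) d p q x :
  (size p <= d.+1)%N -> (size q <= d.+1)%N ->
  d`!%:R * (map_poly f (fconv d p q)).[x]
  = apolar d (map_poly f p) (map_poly f q \Po ('X + x%:P)).
Proof.
move=> sp sq; rewrite fconvE// rmorph_sum horner_sum mulr_sumr.
apply: eq_bigr => i _; rewrite coef_comp_polyXDC /= map_polyZ /= hornerZ.
rewrite nderivn_factE map_polyZ /= hornerZ !rmorphM fmorphV !rmorph_nat.
rewrite nderivn_map coef_map/=.
have ? : d`!%:R != 0 :> C by rewrite pnatr_eq0 -lt0n fact_gt0.
by field.
Qed.

(** Walsh's theorem. If Im z > 0, then q(X + z) has the factors X + (z - x) with x real, so every z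
    - x lies in the upper half-plane and Grace's theorem excludes a root at z. *)
Theorem fconv_splits d p q : size p = d.+1 -> size q = d.+1 -> splits p -> splits q ->
  splits (fconv d p q).
Proof.
move=> sp sq p_splits [s qs]; apply: upper_free_splits => z z0.
have p0 : p != 0 by rewrite -size_poly_eq0 sp.
have lq0 : lead_coef q != 0 by rewrite lead_coef_eq0 -size_poly_eq0 sq.
have d0 : d`!%:R != 0 :> R[i] by rewrite pnatr_eq0 -lt0n fact_gt0.
rewrite /root -(mulrI_eq0 _ (mulfI d0)) fconv_apolar ?sp ?sq//.
pose ws := [seq z - toC x | x <- s].
have -> : map_poly toC q \Po ('X + z%:P) = (toC (lead_coef q))%:P * \prod_(w <- ws) ('X + w%:P).
  rewrite {1}qs map_polyZ /= -mul_polyC comp_polyM comp_polyC; congr (_ * _).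
  rewrite rmorph_prod rmorph_prod big_map/=; apply: eq_bigr => x _.
  by rewrite map_polyXsubC comp_polyB comp_polyX comp_polyC polyCB addrA.
have -> g a : apolar d (map_poly toC p) (a%:P * g) = a * apolar d (map_poly toC p) g.
  rewrite /apolar mulr_sumr; apply: eq_bigr => i _; rewrite coefCM; ring.
rewrite mulf_eq0 negb_or fmorph_eq0 lq0 apolar_neq0//.
- by rewrite size_map_poly.
- exact: splits_upper_free.
- by move: sq; rewrite qs size_scale// size_prod_XsubC size_map => -[].
- by move=> w /mapP[x _ ->]; rewrite raddfB/= -[X in _ - X]complexIm/= subr0.
Qed.

End RealRooted.

(** * Translation, dilation and degree reduction *)

Section Fconv.
Variable R : realType.
Implicit Types p q : {poly R}.

Lemma fact_neq0 d : d`!%:R != 0 :> R.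
Proof. by rewrite pnatr_eq0 -lt0n fact_gt0. Qed.

Lemma size_fconv d p q : (size (fconv d p q) <= d.+1)%N.
Proof. by apply/leq_sizeP => t dt; rewrite coef_fconv leqNgt dt. Qed.

Lemma coef_fconv_top d p q : (fconv d p q)`_d = p`_d * q`_d.
Proof.
rewrite coef_fconv leqnn subnn big_ord1 subn0 addn0 mulfV ?mul1r//.
Qed.

Lemma fconv_monic d p q : size p = d.+1 -> p \is monic ->
  size q = d.+1 -> q \is monic ->
  size (fconv d p q) = d.+1 /\ fconv d p q \is monic.
Proof.
move=> sp /monicP pm sq /monicP qm.
have c1 : (fconv d p q)`_d = 1.
  by rewrite coef_fconv_top; move: pm qm; rewrite !lead_coefE sp sq => -> ->; rewrite mulr1.
have sf : size (fconv d p q) = d.+1.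
  apply/eqP; rewrite eqn_leq size_fconv ltnNge; apply/negP => /leq_sizeP/(_ d (leqnn _)).
  by rewrite c1 => /eqP; rewrite oner_eq0.
by split=> //; rewrite monicE lead_coefE sf c1.
Qed.

Lemma fconvC d p q : fconv d p q = fconv d q p.
Proof.
apply/polyP => t; rewrite !coef_fconv; case: leqP => // td.
rewrite (reindex_inj rev_ord_inj)/=; apply: eq_bigr => i _.
have id : (i <= d - t)%N by rewrite -ltnS.
have -> : (d - ((d - t).+1 - i.+1))%N = (t + i)%N by lia.
have -> : (t + ((d - t).+1 - i.+1))%N = (d - i)%N by lia.
by rewrite [(_`! * _)%N]mulnC mulrAC.
Qed.

Lemma derivn_comp_XDC p b k :
  (p \Po ('X + b%:P))^`(k) = p^`(k) \Po ('X + b%:P).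
Proof.
elim: k => // k IH; rewrite !derivnS IH deriv_comp derivD derivX derivC addr0.
by rewrite mulr1.
Qed.

Lemma size_comp_XDC p b : size (p \Po ('X + b%:P)) = size p.
Proof. by rewrite size_comp_poly2// size_XaddC. Qed.

Lemma fconv_shiftr d p q b : (size p <= d.+1)%N -> (size q <= d.+1)%N ->
  fconv d p (q \Po ('X + b%:P)) = fconv d p q \Po ('X + b%:P).
Proof.
move=> sp sq; rewrite !fconvE ?size_comp_XDC// rmorph_sum/=.
by apply: eq_bigr => i _; rewrite derivn_comp_XDC comp_polyZ.
Qed.

Lemma fconv_shift d p q a b : (size p <= d.+1)%N -> (size q <= d.+1)%N ->
  fconv d (p \Po ('X + a%:P)) (q \Po ('X + b%:P)) = fconv d p q \Po ('X + (a + b)%:P).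
Proof.
move=> sp sq; rewrite fconv_shiftr ?size_comp_XDC// fconvC fconv_shiftr// fconvC.
rewrite -comp_polyA comp_polyD comp_polyX comp_polyC polyCD; congr (_ \Po _).
by rewrite -addrA [X in _ + X]addrC.
Qed.

Lemma coef_comp_scaleX p e k : (p \Po (e *: 'X))`_k = e ^+ k * p`_k.
Proof.
rewrite coef_comp_poly; under eq_bigr do rewrite exprZn coefZ coefXn.
have [kp|pk] := ltnP k (size p); last first.
  rewrite [p`_k]nth_default// mulr0 big1// => i _.
  by rewrite gtn_eqF ?mulr0// (leq_trans (ltn_ord i)).
rewrite (bigD1 (Ordinal kp))//= eqxx mulr1 big1 ?addr0 1?mulrC// => i.
by rewrite -val_eqE/= eq_sym => /negPf ->; rewrite !mulr0.
Qed.

Lemma fconv_scale d p q e :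
  fconv d (p \Po (e *: 'X)) (q \Po (e *: 'X)) = e ^+ d *: (fconv d p q \Po (e *: 'X)).
Proof.
apply/polyP => t; rewrite coefZ coef_comp_scaleX !coef_fconv.
case: leqP => td; last by rewrite !mulr0.
rewrite mulrA -exprD mulr_sumr; apply: eq_bigr => i _.
have id : (i <= d - t)%N by rewrite -ltnS.
rewrite !coef_comp_scaleX; have -> : (d + t = (d - i) + (t + i))%N by lia.
rewrite [in RHS]exprD; ring.
Qed.

(** In [fconvE] the term with the derivative of q of order d + 1 vanishes; shifting the index in the
    others turns the coefficients of p into those of p'. *)
Lemma fconv_lower d p q : (size p <= d.+2)%N -> (size q <= d.+1)%N ->
  fconv d.+1 p q = d.+1%:R^-1 *: fconv d p^`() q.
Proof.
move=> sp sq.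
have sp' : (size p^`() <= d.+1)%N.
  by have [->|/lt_size_deriv] := eqVneq p 0; [rewrite deriv0 size_poly0|lia].
rewrite !fconvE//; last exact: leq_trans sq _.
rewrite big_ord_recl subn0 [q^`(_)](_ : _ = 0) ?scaler0 ?add0r; last first.
  apply/polyP => t; rewrite coef_derivn nth_default ?mul0rn ?coef0//.
  by rewrite (leq_trans sq)// leq_addr.
rewrite scaler_sumr; apply: eq_bigr => i _; rewrite lift0 subSS scalerA.
congr (_ *: _); rewrite coef_deriv -mulr_natr !factS !natrM.
have ? := fact_neq0 d; field.
by rewrite fact_neq0 nat1r pnatr_eq0.
Qed.

Lemma fconv_lowern d j p q : (size p <= (d + j).+1)%N -> (size q <= d.+1)%N ->
  fconv (d + j) p q = (d`!%:R / (d + j)`!%:R) *: fconv d p^`(j) q.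
Proof.
move=> + sq; elim: j p => [|j IH] p sp.
  by rewrite addn0 mulfV ?scale1r// fact_neq0.
rewrite addnS in sp *; rewrite fconv_lower//; last first.
  by rewrite (leq_trans sq)// ltnS leq_addr.
rewrite IH; last first.
  by have [->|/lt_size_deriv] := eqVneq p 0; [rewrite deriv0 size_poly0|lia].
rewrite scalerA derivSn factS natrM; congr (_ *: _).
by rewrite invfM mulrCA.
Qed.

Lemma fconvZl d a p q : fconv d (a *: p) q = a *: fconv d p q.
Proof.
apply/polyP => t; rewrite coefZ !coef_fconv; case: leqP => td; rewrite ?mulr0//.
by rewrite mulr_sumr; apply: eq_bigr => i _; rewrite coefZ; ring.
Qed.

Lemma fconvZr d a p q : fconv d p (a *: q) = a *: fconv d p q.
Proof. by rewrite fconvC fconvZl fconvC. Qed.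

Lemma size_derivn_le p m j : (size p <= m + j)%N -> (size p^`(j) <= m)%N.
Proof.
move=> /leq_sizeP sp; apply/leq_sizeP => t mt; rewrite coef_derivn sp ?mul0rn//; lia.
Qed.

(** The degree is lowered twice: from n = k + (m - r) to k by differentiating p, which then has
    degree at most r, and from k = r + (k - r) to r by differentiating q. *)
Lemma fconv_tangent n m k r p q : (m <= n)%N -> (k <= n)%N -> (m + k = n + r)%N ->
  (size p <= m.+1)%N -> (size q <= k.+1)%N ->
  fconv n p q = (m`!%:R * k`!%:R / (n`!%:R * r`!%:R)) *:
    fconv r ((r`!%:R / m`!%:R) *: p^`(m - r)) ((r`!%:R / k`!%:R) *: q^`(k - r)).
Proof.
move=> mn kn mk sp sq.
have -> : n = (k + (m - r))%N by lia.
rewrite fconv_lowern//; last by rewrite (leq_trans sp)//; lia.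
have ek : k = (r + (k - r))%N by lia.
rewrite fconvC [X in fconv X](ek) fconv_lowern -?ek//; last by apply: size_derivn_le; lia.
rewrite fconvC fconvZl fconvZr !scalerA; congr (_ *: _).
have -> : (k + (m - r))%N = n by lia.
have := fact_neq0 n; have := fact_neq0 m; have := fact_neq0 k; have := fact_neq0 r.
by move=> *; field; do !(apply/andP; split).
Qed.

End Fconv.

(** * Polynomial dependence on the parameter and zooming at a root *)

Section Polyfun.
Variable R : realType.
Implicit Types (f g : R -> R) (p q : R -> {poly R}).

Definition polyfun f := exists P : {poly R}, forall e, f e = P.[e].

(** The uniform size bound lets [polyfun_horner] expand an evaluation as a sum whose length does not
    depend on e. *)
Definition polyfam p :=
  (exists N, forall e, (size (p e) <= N)%N) /\ forall k, polyfun (fun e => (p e)`_k).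

Lemma polyfun_cst a : polyfun (fun=> a).
Proof. by exists a%:P => e; rewrite hornerC. Qed.

Lemma polyfun_id : polyfun id.
Proof. by exists 'X => e; rewrite hornerX. Qed.

Lemma polyfunD f g : polyfun f -> polyfun g -> polyfun (fun e => f e + g e).
Proof. by move=> [P fP] [Q gQ]; exists (P + Q) => e; rewrite hornerD fP gQ. Qed.

Lemma polyfunM f g : polyfun f -> polyfun g -> polyfun (fun e => f e * g e).
Proof. by move=> [P fP] [Q gQ]; exists (P * Q) => e; rewrite hornerM fP gQ. Qed.

Lemma polyfunN f : polyfun f -> polyfun (fun e => - f e).
Proof. by move=> [P fP]; exists (- P) => e; rewrite hornerN fP. Qed.

Lemma polyfun_sum I (s : seq I) (P : pred I) (F : I -> R -> R) :
  (forall i, P i -> polyfun (F i)) -> polyfun (fun e => \sum_(i <- s | P i) F i e).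
Proof.
move=> HF; elim: s => [|i s IH].
  by under [X in polyfun X]eq_fun do rewrite big_nil; exact: polyfun_cst.
under [X in polyfun X]eq_fun do rewrite big_cons.
by case: (boolP (P i)) => // Pi; apply: polyfunD => //; apply: HF.
Qed.

Lemma polyfun_prod I (s : seq I) (P : pred I) (F : I -> R -> R) :
  (forall i, P i -> polyfun (F i)) -> polyfun (fun e => \prod_(i <- s | P i) F i e).
Proof.
move=> HF; elim: s => [|i s IH].
  by under [X in polyfun X]eq_fun do rewrite big_nil; exact: polyfun_cst.
under [X in polyfun X]eq_fun do rewrite big_cons.
by case: (boolP (P i)) => // Pi; apply: polyfunM => //; apply: HF.
Qed.

Lemma polyfunX f n : polyfun f -> polyfun (fun e => f e ^+ n).
Proof. by move=> [P fP]; exists (P ^+ n) => e; rewrite horner_exp fP. Qed.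

Lemma polyfun_cvg f : polyfun f -> f e @[e --> 0^'] --> f 0.
Proof.
move=> [P fP]; have -> : f = horner P by apply/funext.
exact/continuous_withinNx/continuous_horner.
Qed.

Lemma polyfam_cst (p : {poly R}) : polyfam (fun=> p).
Proof. by split; [exists (size p)|move=> k; exact: polyfun_cst]. Qed.

Lemma polyfam_affine (a b : R) f : polyfun f ->
  polyfam (fun e => (a + b * e) *: 'X + (f e)%:P).
Proof.
move=> pf; split.
  exists 2 => e; rewrite (leq_trans (size_polyD _ _))// geq_max size_polyC.
  by rewrite (leq_trans (size_scale_leq _ _)) ?size_polyX// (leq_trans (leq_b1 _)).
move=> k; under [X in polyfun X]eq_fun do rewrite coefD coefZ coefX coefC.
apply: polyfunD.
  by apply: polyfunM (polyfun_cst _); apply: polyfunD; [exact: polyfun_cst|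
    apply: polyfunM polyfun_id; exact: polyfun_cst].
by case: (k == 0%N); [|exact: polyfun_cst].
Qed.

Lemma polyfamM p q : polyfam p -> polyfam q -> polyfam (fun e => p e * q e).
Proof.
move=> [[N pN] pp] [[M qM] pq]; split.
  exists (N + M)%N => e; rewrite (leq_trans (size_polyMleq _ _))//.
  by rewrite (leq_trans (leq_pred _))// leq_add.
move=> k; under [X in polyfun X]eq_fun do rewrite coefM.
by apply: polyfun_sum => i _; apply: polyfunM.
Qed.

Lemma polyfam_prod I (s : seq I) (P : pred I) (F : I -> R -> {poly R}) :
  (forall i, P i -> polyfam (F i)) -> polyfam (fun e => \prod_(i <- s | P i) F i e).
Proof.
move=> HF; elim: s => [|i s IH].
  by under [X in polyfam X]eq_fun do rewrite big_nil; exact: polyfam_cst.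
under [X in polyfam X]eq_fun do rewrite big_cons.
by case: (boolP (P i)) => // Pi; apply: polyfamM => //; apply: HF.
Qed.

Lemma polyfam_deriv p : polyfam p -> polyfam (fun e => (p e)^`()).
Proof.
move=> [[N pN] pp]; split.
  exists N => e; rewrite (leq_trans _ (pN e))//.
  by have [->|/lt_size_deriv/ltnW//] := eqVneq (p e) 0; rewrite deriv0.
move=> k; under [X in polyfun X]eq_fun do rewrite coef_deriv -mulr_natr.
exact: polyfunM (polyfun_cst _).
Qed.

Lemma polyfam_fconv d p q : polyfam p -> polyfam q -> polyfam (fun e => fconv d (p e) (q e)).
Proof.
move=> [_ pp] [_ pq]; split; first by exists d.+1 => e; exact: size_fconv.
move=> k; under [X in polyfun X]eq_fun do rewrite coef_fconv.
case: (leqP k d) => _; last exact: polyfun_cst.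
by apply: polyfun_sum => i _; apply: polyfunM => //; apply: polyfunM => //; exact: polyfun_cst.
Qed.

Lemma polyfun_horner p f : polyfam p -> polyfun f -> polyfun (fun e => (p e).[f e]).
Proof.
move=> [[N pN] pp] pf; under [X in polyfun X]eq_fun => e do rewrite (horner_coef_wide _ (pN e)).
by apply: polyfun_sum => i _; apply: polyfunM => //; exact: polyfunX.
Qed.

Lemma polyfam_h_poly n (alpha beta u v : 'rV[R]_n) : polyfam (h_poly alpha beta u v).
Proof.
have rp (x y : 'rV[R]_n) : polyfam (fun e => root_poly (x + e *: y)).
  apply: polyfam_prod => i _.
  have -> : (fun e => 'X - ((x + e *: y) 0 i)%:P) =
      (fun e => (1 + 0 * e) *: 'X + (- x 0 i - e * y 0 i)%:P).
    by apply/funext => e; rewrite !mxE mul0r addr0 scale1r -opprD polyCN.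
  apply/polyfam_affine/polyfunD; first exact: polyfun_cst.
  by apply/polyfunN/polyfunM; [exact: polyfun_id|exact: polyfun_cst].
exact: polyfam_fconv.
Qed.


Lemma polyfam_root_poly_cluster n (I : {set 'I_n}) (u : 'rV[R]_n) (x : 'I_n -> R) :
  polyfam (fun e => \prod_(i in ~: I) (e *: 'X + (x i - e * u 0 i)%:P)).
Proof.
apply: polyfam_prod => i _.
have -> : (fun e => e *: 'X + (x i - e * u 0 i)%:P) =
    (fun e => (0 + 1 * e) *: 'X + (x i - e * u 0 i)%:P).
  by apply/funext => e; rewrite mul1r add0r.
apply/polyfam_affine/polyfunD; first exact: polyfun_cst.
by apply/polyfunN/polyfunM; [exact: polyfun_id|exact: polyfun_cst].
Qed.

Lemma root_poly_zoom n (alpha u : 'rV[R]_n) a e :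
  root_poly (alpha + e *: u) \Po ('X + a%:P) \Po (e *: 'X) =
  e ^+ #|index_set alpha a| *:
   (\prod_(i in index_set alpha a) ('X - (u 0 i)%:P) *
    \prod_(i in ~: index_set alpha a) (e *: 'X + (a - alpha 0 i - e * u 0 i)%:P)).
Proof.
rewrite /root_poly !rmorph_prod/= (bigID (fun i => i \in index_set alpha a))/= scalerAl.
congr (_ * _).
  rewrite -prodr_const -scaler_prod; apply: eq_bigr => i; rewrite inE => /eqP ai.
  rewrite !(comp_polyB, comp_polyD, comp_polyX, comp_polyC) !mxE ai.
  by rewrite scalerBr -!mul_polyC polyCD polyCM opprD; ring.
apply: eq_big => [i|i _]; first by rewrite !inE.
rewrite !(comp_polyB, comp_polyD, comp_polyX, comp_polyC) !mxE.
by rewrite -addrA -polyCB; congr (_ + _%:P); ring.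
Qed.

Lemma size_root_poly n (x : 'rV[R]_n) : size (root_poly x) = n.+1.
Proof. by rewrite size_prod_XsubC /index_enum -enumT size_enum_ord. Qed.

(** With m = #|I|, the factor r!/m! is the inverse of the leading coefficient of the derivative of
    order m - r of U, and derivation preserves real-rootedness. *)
Lemma reduced_polyP n (I : {set 'I_n}) (u : 'rV[R]_n) r : (r <= #|I|)%N ->
  [/\ size (reduced_poly I u r) = r.+1, reduced_poly I u r \is monic & splits (reduced_poly I u r)].
Proof.
move=> rI; set U := \prod_(i in I) ('X - (u 0 i)%:P).
have UE : U = \prod_(x <- [seq u 0 i | i in I]) ('X - x%:P) by rewrite big_image.
have sU : size U = #|I|.+1 by rewrite UE size_prod_XsubC size_image.
have mU : U`_#|I| = 1.
  have : U \is monic by apply: monic_prod_XsubC.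
  by rewrite monicE lead_coefE sU => /eqP.
have c1 : (reduced_poly I u r)`_r = 1.
  rewrite coefZ coef_derivn subnK// mU -[1 *+ _]mulr_natr mul1r.
  have <- : (#|I| ^_ (#|I| - r))%:R * r`!%:R = (#|I|)`!%:R :> R.
    by rewrite -natrM -{2}(subKn rI) ffact_fact// leq_subr.
  have := fact_neq0 R r; have : (#|I| ^_ (#|I| - r))%:R != 0 :> R.
    by rewrite pnatr_eq0 -lt0n ffact_gt0 leq_subr.
  by move=> *; field; apply/andP.
have sr : size (reduced_poly I u r) = r.+1.
  apply/eqP; rewrite eqn_leq ltnNge; apply/andP; split.
    rewrite (leq_trans (size_scale_leq _ _))// size_derivn_le//.
    by rewrite addSn subnKC// sU.
  by apply/negP => /leq_sizeP/(_ r (leqnn _)); rewrite c1 => /eqP; rewrite oner_eq0.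
split=> //; first by rewrite monicE lead_coefE sr c1.
apply/splitsZ/splits_derivn.
exists [seq u 0 i | i in I].
by rewrite -/U UE lead_coef_prod_XsubC scale1r.
Qed.

(* After the rescaling x = c + e z, the polynomial e^-r h_e tends to a constant multiple of Q. *)
Definition zooms_to n (alpha beta u v : 'rV[R]_n) (c : R) (r : nat) (Q : {poly R}) :=
  exists2 C, C != 0 & forall z, exists W : R -> R,
    [/\ polyfun W, W 0 = C * Q.[z] &
        forall e, e != 0 -> (h_poly alpha beta u v e).[c + e * z] = e ^+ r * W e].

Lemma tangent_poly_multiple n (alpha beta u v : 'rV[R]_n) c r : r != 1 ->
  separable_poly (tangent_poly alpha beta u v c r) ->
  let Q := tangent_poly alpha beta u v c r in
  [/\ size Q = r.+1, Q \is monic, splits Q & zooms_to alpha beta u v c r Q].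
Proof.
move=> r1; rewrite /tangent_poly (negPf r1).
case: pickP => [[i j] /= /andP[/eqP ab /eqP mk] _ | _]; last first.
  by move/separable_poly_neq0; rewrite eqxx.
set a := alpha 0 i in ab mk *; set b := beta 0 j in ab mk *.
set I := index_set alpha a in mk *; set J := index_set beta b in mk *.
have mn : (#|I| <= n)%N by rewrite -[X in (_ <= X)%N]card_ord max_card.
have kn : (#|J| <= n)%N by rewrite -[X in (_ <= X)%N]card_ord max_card.
have rI : (r <= #|I|)%N by rewrite -(leq_add2l n) -mk addnC leq_add2r.
have rJ : (r <= #|J|)%N by rewrite -(leq_add2l n) -mk leq_add2r.
have [sU mU rU] := reduced_polyP u rI.
have [sV mV rV] := reduced_polyP v rJ.
have [sQ mQ] := fconv_monic sU mU sV mV.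
split=> //; first exact: fconv_splits.
pose U := \prod_(i in I) ('X - (u 0 i)%:P); pose V := \prod_(i in J) ('X - (v 0 i)%:P).
pose A e := \prod_(i in ~: I) (e *: 'X + (a - alpha 0 i - e * u 0 i)%:P).
pose B e := \prod_(i in ~: J) (e *: 'X + (b - beta 0 i - e * v 0 i)%:P).
pose A0 := \prod_(i in ~: I) (a - alpha 0 i); pose B0 := \prod_(i in ~: J) (b - beta 0 i).
have A0n : A0 != 0.
  by apply/prodf_neq0 => l; rewrite !inE subr_eq0 eq_sym.
have B0n : B0 != 0.
  by apply/prodf_neq0 => l; rewrite !inE subr_eq0 eq_sym.
have EA : A 0 = A0%:P.
  by rewrite rmorph_prod; apply: eq_bigr => l _; rewrite scale0r add0r mul0r subr0.
have EB : B 0 = B0%:P.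
  by rewrite rmorph_prod; apply: eq_bigr => l _; rewrite scale0r add0r mul0r subr0.
have mkn : (#|I|)`!%:R * (#|J|)`!%:R / (n`!%:R * r`!%:R) != 0 :> R.
  by rewrite !mulf_neq0 ?invr_eq0 ?mulf_neq0 ?fact_neq0.
exists (A0 * B0 * ((#|I|)`!%:R * (#|J|)`!%:R / (n`!%:R * r`!%:R))).
  by rewrite !mulf_neq0.
move=> z; exists (fun e => (fconv n (U * A e) (V * B e)).[z]); split.
- apply: polyfun_horner; last exact: polyfun_cst.
  by apply: polyfam_fconv; apply: polyfamM; rewrite ?/A ?/B;
    [exact: polyfam_cst|exact: polyfam_root_poly_cluster
    |exact: polyfam_cst|exact: polyfam_root_poly_cluster].
- rewrite EA EB ![_ * _%:P]mulrC !mul_polyC fconvZl fconvZr.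
  have sU' : (size U <= (#|I|).+1)%N.
    have -> : U = \prod_(x <- [seq u 0 i | i in I]) ('X - x%:P) by rewrite big_image.
    by rewrite size_prod_XsubC size_image.
  have sV' : (size V <= (#|J|).+1)%N.
    have -> : V = \prod_(x <- [seq v 0 i | i in J]) ('X - x%:P) by rewrite big_image.
    by rewrite size_prod_XsubC size_image.
  by rewrite (fconv_tangent mn kn mk sU' sV') !hornerZ !mulrA.
(* The two zooms produce e^(m+k) = e^n e^r, while [fconv_scale] supplies a factor e^n on the other
   side; multiplying by e^n beforehand matches them. *)
- move=> e e0; apply: (mulfI (expf_neq0 n e0)).
  rewrite mulrA -exprD -mk exprD.
  have -> : (h_poly alpha beta u v e).[c + e * z] =
     (h_poly alpha beta u v e \Po ('X + (a + b)%:P) \Po (e *: 'X)).[z].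
    by rewrite ab !horner_comp hornerZ hornerX hornerD hornerX hornerC addrC.
  rewrite -hornerZ /h_poly -fconv_shift ?size_root_poly// -fconv_scale.
  by rewrite !root_poly_zoom fconvZl fconvZr scalerA hornerZ.
Qed.

(** Here h_e(c) = e G(e), and the increment from c to c + e z is e z T(e), where T is a divided
    difference of h_e and T(0) = h_0'(c). So W = G + z T, and W(0) = h_0'(c) (z - lambda) because
    G(0) is the derivative of h_e(c) at e = 0. *)
Lemma tangent_poly_simple n (alpha beta u v : 'rV[R]_n) c :
  root (h_poly alpha beta u v 0) c -> ~~ root (h_poly alpha beta u v 0)^`() c ->
  let Q := tangent_poly alpha beta u v c 1 in
  [/\ size Q = 2, Q \is monic, splits Q & zooms_to alpha beta u v c 1 Q].
Proof.
move=> hc h'c; rewrite /tangent_poly eqxx; set h := h_poly alpha beta u v in hc h'c *.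
set l := - _ / _.
split; [exact: size_XsubC|exact: monicXsubC| |].
  by exists [:: l]; rewrite lead_coefXsubC scale1r big_seq1.
exists (h 0)^`().[c] => // z.
have [[N hN] ph] := polyfam_h_poly alpha beta u v.
have [P hP] : polyfun (fun e => (h e).[c]).
  exact: polyfun_horner (polyfam_h_poly _ _ _ _) (polyfun_cst c).
have [G PG] : exists G, P = 'X * G.
  have : root P 0 by rewrite /root -hP.
  by move=> /factor_theorem[G ->]; exists G; rewrite subr0 mulrC.
have dP : derive1 (fun e => (h e).[c]) 0 = G.[0].
  have -> : (fun e => (h e).[c]) = horner P by apply/funext.
  by rewrite derive1E derive_val PG derivM derivX mul1r hornerD hornerM !hornerX mul0r addr0.
pose T e := \sum_(k < N.+1) (h e)`_k * \sum_(i < k) (c + e * z) ^+ (k - i.+1) * c ^+ i.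
exists (fun e => G.[e] + z * T e); split.
- apply: polyfunD; first by exists G.
  apply: polyfunM; first exact: polyfun_cst.
  apply: polyfun_sum => k _; apply: polyfunM => //; apply: polyfun_sum => i _.
  apply: polyfunM; last exact: polyfun_cst.
  apply: polyfunX; apply: polyfunD; first exact: polyfun_cst.
  by apply: polyfunM; [exact: polyfun_id|exact: polyfun_cst].
- have -> : T 0 = (h 0)^`().[c].
    have sh' : (size (h 0%R)^`() <= N)%N.
      have := hN 0; have [->|/lt_size_deriv] := eqVneq (h 0) 0; last by rewrite /h; lia.
      by rewrite deriv0 size_poly0.
    rewrite (horner_coef_wide _ sh') /T big_ord_recl big_ord0 mulr0 add0r.
    apply: eq_bigr => k _; rewrite lift0 coef_deriv mulrnAl -mulrnAr; congr (_ * _).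
    rewrite -[X in _ *+ X]card_ord -sumr_const; apply: eq_bigr => i _.
    by rewrite mul0r addr0 -exprD subSS subnK// -ltnS.
  rewrite hornerXsubC mulrBr /l dP.
  by move: h'c; rewrite /root => ?; field.
move=> e _; rewrite expr1 mulrDr; have := hP e; rewrite PG hornerM hornerX => <-.
rewrite !(horner_coef_wide _ (leqW (hN e))) -[LHS](subrK (\sum_(i < N.+1) (h e)`_i * c ^+ i)) addrC.
congr (_ + _); rewrite -sumrB /T !mulr_sumr; apply: eq_bigr => k _.
rewrite -mulrBr subrXX [c + _ - c]addrAC subrr add0r -/h.
have -> : \sum_(i < k) (c + e * z) ^+ (k.-1 - i) * c ^+ i =
    \sum_(i < k) (c + e * z) ^+ (k - i.+1) * c ^+ i.
  by apply: eq_bigr => i _; rewrite -subn1 -subnDA add1n.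
ring.
Qed.

End Polyfun.

(** * Entropy, score and discriminant as sums over the roots *)

Section RootSums.
Variable R : realType.

(* The diagonal terms vanish because ln 0 = 0 and 0^-1 = 0. *)
Definition log_sum (T : finType) (x : T -> R) : R := \sum_s \sum_t ln `|x s - x t|.

Definition score_sum (T : finType) (x : T -> R) : R :=
  \sum_s (\sum_t (x s - x t)^-1) ^+ 2.

(** [root_vec] is a chosen enumeration, and any other one is a permutation of it. Through such
    symmetric sums every notion defined from [root_vec] is transferred to roots indexed by an
    arbitrary finite type. *)
Lemma root_vec_sum (T : finType) (x : T -> R) d p : #|T| = d ->
  p = \prod_t ('X - (x t)%:P) ->
  forall F : R -> R, \sum_i F (root_vec d p 0 i) = \sum_t F (x t).
Proof.
move=> cT px F.
have : p = root_poly (root_vec d p).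
  rewrite /root_vec; case: xgetP => [_ -> // | /(_ (\row_i x (enum_val (cast_ord (esym cT) i))))].
  case; rewrite /= px /root_poly.
  rewrite (reindex (fun i => enum_val (cast_ord (esym cT) i))).
    by apply: eq_bigr => i _; rewrite mxE.
  exists (fun t => cast_ord cT (enum_rank t)) => i _.
    by rewrite enum_valK cast_ordKV.
  by rewrite cast_ordK enum_rankK.
have imP (J : finType) (y : J -> R) :
    \prod_t ('X - (y t)%:P) = \prod_(z <- [seq y t | t : J]) ('X - z%:P).
  by rewrite big_image.
rewrite {1}px /root_poly !imP => /prod_XsubC_eq/(perm_big _) H.
by have := H R +%R 0 predT F; rewrite !big_image.
Qed.

Lemma root_vec_sum2 (T : finType) (x : T -> R) d p : #|T| = d ->
  p = \prod_t ('X - (x t)%:P) -> forall F : R -> R -> R,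
  \sum_i \sum_j F (root_vec d p 0 i) (root_vec d p 0 j) = \sum_s \sum_t F (x s) (x t).
Proof.
move=> cT px F; under eq_bigr do rewrite (root_vec_sum cT px).
exact: (root_vec_sum cT px (fun y => \sum_t F y (x t))).
Qed.

Lemma root_vec_inj (T : finType) (x : T -> R) d p : #|T| = d -> injective x ->
  p = \prod_t ('X - (x t)%:P) -> injective (root_vec d p 0).
Proof.
move=> cT ix px.
(* The number of pairs of equal roots does not depend on the enumeration. *)
have /eqP := root_vec_sum2 cT px (fun y z => (y == z)%:R).
have -> : \sum_s \sum_t (x s == x t)%:R = d%:R :> R.
  rewrite -cT -[RHS]mulr1 mulr_natl -sumr_const; apply: eq_bigr => s _.
  rewrite (bigD1 s)//= eqxx big1 ?addr0// => t ts.
  by rewrite (inj_eq ix) eq_sym (negPf ts).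
have -> : d%:R = \sum_(i < d) 1 :> R by rewrite sumr_const card_ord.
rewrite -subr_eq0 -sumrB psumr_eq0 => [/allP H i j ij|i _]; last first.
  by rewrite (bigD1 i)//= eqxx addrC addrK sumr_ge0.
apply/eqP; rewrite eq_sym; apply/negPn/negP => ji.
have := H i (mem_index_enum _); rewrite (bigD1 i)//= eqxx addrC addrK (bigD1 j)//= ij eqxx.
by rewrite gt_eqF// ltr_wpDr// sumr_ge0.
Qed.

Lemma sum_lt_pairs d (F : 'I_d -> 'I_d -> R) : (forall i, F i i = 0) ->
  (forall i j, F i j = F j i) ->
  2 * (\sum_(i < d) \sum_(j < d | (i < j)%N) F i j) = \sum_i \sum_j F i j.
Proof.
move=> Fd Fs; rewrite mulr_natl mulr2n.
have {2}-> : \sum_(i < d) \sum_(j < d | (i < j)%N) F i j =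
    \sum_(i < d) \sum_(j < d | (j < i)%N) F i j.
  rewrite (exchange_big_dep xpredT)//=; apply: eq_bigr => i _; apply: eq_bigr => j _; exact: Fs.
rewrite -big_split/=; apply: eq_bigr => i _.
rewrite [RHS](bigID (fun j : 'I_d => (i < j)%N))/=; congr (_ + _).
rewrite [RHS](bigD1 i) ?ltnn//= Fd add0r; apply: eq_bigl => j.
by rewrite -leqNgt ltn_neqAle andbC.
Qed.

Lemma ln_prodr (I : finType) (P : pred I) (F : I -> R) : (forall i, P i -> 0 < F i) ->
  ln (\prod_(i | P i) F i) = \sum_(i | P i) ln (F i).
Proof.
move=> F0.
suff [] : 0 < \prod_(i | P i) F i /\ ln (\prod_(i | P i) F i) = \sum_(i | P i) ln (F i) by [].
apply: (big_rec2 (fun a b => 0 < a /\ ln a = b)); first by rewrite ln1.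
by move=> i a b Pi [a0 <-]; rewrite mulr_gt0 ?F0// lnM// posrE F0.
Qed.

Variables (T : finType) (x : T -> R) (d : nat) (p : {poly R}).
Hypotheses (cT : #|T| = d) (ix : injective x) (px : p = \prod_t ('X - (x t)%:P)).

Lemma log_sum_root_vec : log_sum (root_vec d p 0) = log_sum x.
Proof. exact: (root_vec_sum2 cT px (fun y z => ln `|y - z|)). Qed.

Lemma sum_log_lt (m : nat) (y : 'I_m -> R) :
  2 * (\sum_(i < m) \sum_(j < m | (i < j)%N) ln `|y i - y j|) = log_sum y.
Proof.
apply: sum_lt_pairs => [i|i j]; first by rewrite subrr normr0 ln0.
by rewrite distrC.
Qed.

Lemma entropy_roots : entropy d p = (log_sum x / (d%:R * (d%:R - 1)))%:E.
Proof.
rewrite /entropy; have /injectiveP -> := root_vec_inj cT ix px.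
by rewrite -log_sum_root_vec -sum_log_lt; congr EFin; rewrite mulrAC.
Qed.

Lemma sqnorm2_score_roots : sqnorm2 (score (root_vec d p)) = score_sum x.
Proof.
transitivity (score_sum (root_vec d p 0)).
  apply: eq_bigr => i _; rewrite mxE [in RHS](bigD1 i)//= subrr invr0 add0r.
  by [].
rewrite /score_sum -(root_vec_sum cT px (fun y => (\sum_t (y - x t)^-1) ^+ 2)).
by apply: eq_bigr => i _; rewrite (root_vec_sum cT px (fun y => (root_vec d p 0 i - y)^-1)).
Qed.

Lemma fisher_roots :
  fisher d p = (4 / (d%:R * (d%:R - 1) ^+ 2) * score_sum x)%:E.
Proof.
rewrite /fisher; have /injectiveP -> := root_vec_inj cT ix px.
by rewrite sqnorm2_score_roots.
Qed.

Lemma disc_roots : 0 < disc d p /\ ln (disc d p) = log_sum x.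
Proof.
have ir := root_vec_inj cT ix px.
have n0 (i j : 'I_d) : (i < j)%N -> 0 < (root_vec d p 0 i - root_vec d p 0 j) ^+ 2.
  move=> ij; rewrite exprn_even_gt0//= subr_eq0; apply: contraTneq ij => /ir ->.
  by rewrite ltnn.
split; first by apply: prodr_gt0 => i _; apply: prodr_gt0 => j; exact: n0.
rewrite ln_prodr => [|i _]; last by apply: prodr_gt0 => j; exact: n0.
rewrite -log_sum_root_vec -sum_log_lt mulr_sumr; apply: eq_bigr => i _.
rewrite ln_prodr => [|j]; last exact: n0.
rewrite mulr_sumr; apply: eq_bigr => j ij.
rewrite -real_normK ?num_real// lnXn ?mulr_natl//.
by have := n0 _ _ ij; rewrite exprn_even_gt0//= normr_gt0.
Qed.

End RootSums.

(** * Symmetric functions of the roots through the companion matrix *)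

Section Companion.
Variable R : realType.

Lemma horner_deriv_root (T : finType) (x : T -> R) t :
  (\prod_s ('X - (x s)%:P))^`().[x t] = \prod_(s | s != t) (x t - x s).
Proof.
rewrite (bigD1 t)//= derivM derivXsubC mul1r hornerD hornerM hornerXsubC subrr.
by rewrite mul0r addr0 horner_prod; apply: eq_bigr => s _; rewrite hornerXsubC.
Qed.

Lemma horner_deriv2_root (T : finType) (x : T -> R) t : injective x ->
  (\prod_s ('X - (x s)%:P))^`(2).[x t] =
  2 * \prod_(s | s != t) (x t - x s) * \sum_s (x t - x s)^-1.
Proof.
move=> ix; rewrite (bigD1 t)//=.
have -> : \prod_(s | s != t) ('X - (x s)%:P) =
    \prod_(y <- [seq x s | s in predC1 t]) ('X - y%:P) by rewrite big_image.
set q := \prod_(_ <- _) _.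
have -> : (('X - (x t)%:P) * q)^`(2).[x t] = 2 * q^`().[x t].
  rewrite derivnS derivn1 derivM derivXsubC mul1r derivD derivM derivXsubC mul1r !hornerD hornerM hornerXsubC.
  by rewrite subrr mul0r addr0 mulr_natl mulr2n.
rewrite horner_deriv_prod_XsubC => [|y /mapP[s]]; last first.
  by rewrite mem_enum inE => st ->; rewrite (inj_eq ix) eq_sym.
rewrite -mulrA horner_prod !big_image /=; congr (_ * (_ * _)).
  by apply: eq_bigr => s _; rewrite hornerXsubC.
by rewrite [RHS](bigD1 t)//= subrr invr0 add0r.
Qed.

Definition mpolyfun m n (A : R -> 'M[R]_(m, n)) := forall i j, polyfun (fun e => A e i j).

Lemma mpolyfunM m n q (A : R -> 'M[R]_(m, n)) (B : R -> 'M[R]_(n, q)) :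
  mpolyfun A -> mpolyfun B -> mpolyfun (fun e => A e *m B e).
Proof.
move=> pA pB i j; under [X in polyfun X]eq_fun do rewrite mxE.
by apply: polyfun_sum => k _; apply: polyfunM.
Qed.

Lemma polyfun_det n (A : R -> 'M[R]_n) : mpolyfun A -> polyfun (fun e => \det (A e)).
Proof.
move=> pA; apply: polyfun_sum => s _; apply: polyfunM; first exact: polyfun_cst.
by apply: polyfun_prod => i _; apply: pA.
Qed.

Lemma mpolyfun_adj n (A : R -> 'M[R]_n) : mpolyfun A -> mpolyfun (fun e => \adj (A e)).
Proof.
move=> pA i j; under [X in polyfun X]eq_fun do rewrite mxE.
apply: polyfunM; first exact: polyfun_cst.
apply: polyfun_det => k l; under [X in polyfun X]eq_fun do rewrite !mxE; exact: pA.
Qed.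

Lemma polyfun_tr n (A : R -> 'M[R]_n) : mpolyfun A -> polyfun (fun e => \tr (A e)).
Proof. by move=> pA; apply: polyfun_sum => i _; apply: pA. Qed.

(* The rows of a companion matrix act on the columns (1, x, ..., x^m) as multiplication by x. *)
Definition companion m (p : {poly R}) : 'M[R]_m.+1 :=
  \matrix_(i, j) if (i.+1 < m.+1)%N then (j == i.+1 :> nat)%:R else - p`_j.

Lemma companion_Vandermonde m (x : 'I_m.+1 -> R) p : p = \prod_i ('X - (x i)%:P) ->
  companion m p *m Vandermonde m.+1 (\row_i x i) =
  Vandermonde m.+1 (\row_i x i) *m diag_mx (\row_i x i).
Proof.
move=> px; apply/matrixP => i j; rewrite mul_mx_diag !mxE -exprSr.
have [im|im] := boolP (i.+1 < m.+1)%N.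
  under eq_bigr do rewrite !mxE im.
  rewrite (bigD1 (Ordinal im))//= eqxx mul1r big1 ?addr0// => k.
  by rewrite -val_eqE/= => /negPf ->; rewrite mul0r.
under eq_bigr do rewrite !mxE (negPf im).
have -> : i.+1 = m.+1 by have := ltn_ord i; move: im; rewrite -leqNgt; lia.
have sp : size p = m.+2 by rewrite px size_prod_XsubC /index_enum -enumT size_enum_ord.
have pm : p`_m.+1 = 1.
  have : p \is monic by rewrite px monic_prod_XsubC.
  by rewrite monicE lead_coefE sp => /eqP.
have : p.[x j] = 0.
  by apply/rootP; rewrite px (bigD1 j)//= rootM root_XsubC eqxx.
rewrite horner_coef sp big_ord_recr/= pm mul1r => /eqP; rewrite addrC addr_eq0 => /eqP ->.
by rewrite -sumrN; apply: eq_bigr => k _; rewrite mulNr.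
Qed.

(** The value of g at the companion matrix. The bound N is fixed so that the sum keeps the same
    length when g varies with e. *)
Definition comp_horner m N (p g : {poly R}) : 'M[R]_m.+1 :=
  \sum_(k < N) g`_k *: companion m p ^+ k.

(** The columns of the Vandermonde matrix are common eigenvectors, with eigenvalues g(x_i). *)
Lemma comp_hornerP m N (x : 'I_m.+1 -> R) (p g : {poly R}) : p = \prod_i ('X - (x i)%:P) ->
  (size g <= N)%N ->
  comp_horner m N p g *m Vandermonde m.+1 (\row_i x i) =
  Vandermonde m.+1 (\row_i x i) *m diag_mx (\row_i g.[x i]).
Proof.
move=> px gN; set V := Vandermonde _ _; set C := companion m p.
have CV k : C ^+ k *m V = V *m diag_mx (\row_i x i ^+ k).
  elim: k => [|k IH].
    rewrite expr0 mul1mx (_ : \row_i _ = const_mx 1) ?diag_const_mx ?mulmx1//.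
    by apply/rowP => i; rewrite !mxE expr0.
  rewrite exprSr -mulmxA companion_Vandermonde// mulmxA IH -mulmxA mulmx_diag.
  by congr (_ *m diag_mx _); apply/rowP => i; rewrite !mxE exprSr.
rewrite /comp_horner mulmx_suml.
under eq_bigr do rewrite -scalemxAl CV.
apply/matrixP => i j; rewrite summxE mul_mx_diag !mxE (horner_coef_wide _ gN) mulr_sumr.
apply: eq_bigr => k _; rewrite mxE mul_mx_diag !mxE; ring.
Qed.

Lemma mpolyfun_comp_horner m N p g : polyfam p -> polyfam g ->
  mpolyfun (fun e => comp_horner m N (p e) (g e)).
Proof.
move=> [_ pp] [_ pg].
have pC : mpolyfun (fun e => companion m (p e)).
  move=> i j; under [X in polyfun X]eq_fun do rewrite mxE.
  by case: (i.+1 < m.+1)%N; [exact: polyfun_cst|exact: polyfunN].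
have pCX k : mpolyfun (fun e => companion m (p e) ^+ k).
  elim: k => [|k IH]; first by move=> i j; exact: polyfun_cst.
  by under [X in mpolyfun X]eq_fun do rewrite exprS; exact: mpolyfunM.
move=> i j; under [X in polyfun X]eq_fun do rewrite summxE.
apply: polyfun_sum => k _; under [X in polyfun X]eq_fun do rewrite mxE.
by apply: polyfunM => //; exact: pCX.
Qed.

(** The matrix p'(companion) has determinant P, the product of the p'(x_i). Its adjugate stands in
    for its inverse to keep the entries polynomial in e: M then has eigenvalues p''(x_i) P / p'(x_i)
    = 2 P s_i, and tr M^2 = 4 P^2 |s|^2. *)
Lemma sym_polyfun m (p : R -> {poly R}) : polyfam p ->
  exists P N : R -> R, [/\ polyfun P, polyfun N &
    forall e (x : 'I_m.+1 -> R), injective x -> p e = \prod_i ('X - (x i)%:P) ->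
    P e = \prod_i (p e)^`().[x i] /\ N e = 4 * P e ^+ 2 * score_sum x].
Proof.
move=> pp.
have pp1 := polyfam_deriv pp; have pp2 := polyfam_deriv pp1.
have [[N1 s1] _] := pp1; have [[N2 s2] _] := pp2.
pose B1 e := comp_horner m N1 (p e) (p e)^`(); pose B2 e := comp_horner m N2 (p e) (p e)^`()^`().
have pB1 : mpolyfun B1 by exact: mpolyfun_comp_horner.
have pB2 : mpolyfun B2 by exact: mpolyfun_comp_horner.
pose M e := B2 e *m \adj (B1 e).
exists (fun e => \det (B1 e)), (fun e => \tr (M e *m M e)); split.
- exact: polyfun_det.
- have pM : mpolyfun M by apply: mpolyfunM => //; exact: mpolyfun_adj.
  exact/polyfun_tr/mpolyfunM.
move=> e x ix px; set V := Vandermonde m.+1 (\row_i x i).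
have dV : \det V != 0.
  rewrite det_Vandermonde; apply/prodf_neq0 => i _; apply/prodf_neq0 => j ij.
  by rewrite !mxE subr_eq0 (inj_eq ix) neq_ltn ij orbT.
have uV : V \in unitmx by rewrite unitmxE unitfE.
have E1 := comp_hornerP px (s1 e); have E2 := comp_hornerP px (s2 e).
rewrite -/V -/(B1 e) in E1; rewrite -/V -/(B2 e) in E2.
set p1 := fun i => (p e)^`().[x i] in E1 *.
set p2 := fun i => (p e)^`()^`().[x i] in E2 *.
have p1E i : p1 i = \prod_(j | j != i) (x i - x j) by rewrite /p1 px horner_deriv_root.
have p1n i : p1 i != 0.
  by rewrite p1E; apply/prodf_neq0 => j ji; rewrite subr_eq0 (inj_eq ix) eq_sym.
have p2E i : p2 i = 2 * p1 i * \sum_j (x i - x j)^-1.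
  by rewrite p1E -horner_deriv2_root// -px.
have detB : \det (B1 e) = \prod_i p1 i.
  apply: (mulIf dV); rewrite -det_mulmx E1 det_mulmx det_diag mulrC; congr (_ * _).
  by apply: eq_bigr => i _; rewrite mxE.
split=> //.
have uB : B1 e \in unitmx.
  by rewrite unitmxE unitfE detB; apply/prodf_neq0 => i _.
have adjV : \adj (B1 e) *m V = V *m diag_mx (\row_i (\det (B1 e) / p1 i)).
  apply: (can_inj (mulKmx uB)); rewrite !mulmxA mul_mx_adj E1 -mulmxA mulmx_diag mul_scalar_mx.
  rewrite (_ : \row_i _ = const_mx (\det (B1 e))).
    by rewrite diag_const_mx mul_mx_scalar.
  by apply/rowP => i; rewrite !mxE mulrC divfK.
have MV : M e *m V = V *m diag_mx (\row_i (p2 i * (\det (B1 e) / p1 i))).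
  rewrite /M -mulmxA adjV mulmxA E2 -mulmxA mulmx_diag.
  by congr (_ *m diag_mx _); apply/rowP => i; rewrite !mxE.
have -> : M e *m M e = V *m diag_mx (\row_i (p2 i * (\det (B1 e) / p1 i)) ^+ 2) *m invmx V.
  apply: (can_inj (mulmxK uV)); rewrite -[RHS]mulmxA mulVmx// mulmx1 -mulmxA MV mulmxA MV.
  rewrite -mulmxA mulmx_diag; congr (_ *m diag_mx _); apply/rowP => i.
  by rewrite !mxE.
rewrite mxtrace_mulC mulmxA mulVmx// mul1mx mxtrace_diag mulr_sumr.
apply: eq_bigr => i _; rewrite mxE p2E; field; exact: p1n.
Qed.

End Companion.

(** * Power series solutions of linear ODEs *)

Section ODE.
Variable R : realType.
Implicit Types (f w q : R -> R) (a b : R^nat) (G A B P : {poly R}).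

(* w^2 exp(-2Lx) is nonincreasing for x > 0 and vanishes at 0. *)
Lemma linear_ode_zero_right w q (d L : R) :
  (forall x, `|x| < d -> is_derive (x : R) (1 : R) w (q x * w x)) ->
  (forall x, `|x| < d -> `|q x| <= L) -> w 0 = 0 ->
  forall x, 0 < x -> x < d -> w x = 0.
Proof.
move=> dw qL w0 x x0 xd.
have Hd y : y \in `[0, x] -> `|y| < d.
  by rewrite in_itv/= => /andP[y0 yx]; rewrite ger0_norm// (le_lt_trans yx).
pose v := fun t : R => w t ^+ 2 * expR (- (2 * L) * t).
pose dv := fun t : R => 2 * w t ^+ 2 * (q t - L) * expR (- (2 * L) * t).
have Hv y : `|y| < d -> is_derive y (1 : R) v (dv y).
  move=> yd; have ? := dw y yd.
  have ? : is_derive y (1 : R) (fun t : R => - (2 * L) * t) (- (2 * L)).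
    by apply: is_derive_eq; rewrite [_ *: _]mulr1.
  have ? : is_derive y (1 : R) (fun t : R => expR (- (2 * L) * t)) (expR (- (2 * L) * y) * - (2 * L)).
    exact: is_derive1_comp.
  apply: is_derive_eq; rewrite /dv /GRing.scale/=; ring.
have cv : {within `[0, x], continuous v}.
  by apply: derivable_within_continuous => y /Hd /Hv[].
have [y yx] : exists2 y, y \in `]0, x[ & v x - v 0 = dv y * (x - 0).
  apply: MVT => // y yx; apply/Hv/Hd; exact: subset_itv_oo_cc.
rewrite {2}/v w0 expr0n mul0r !subr0 => vx.
have : v x <= 0.
  rewrite vx pmulr_lle0// pmulr_lle0 ?expR_gt0// mulr_ge0_le0//.
    by rewrite mulr_ge0// sqr_ge0.
  by rewrite subr_le0 (le_trans (ler_norm _))// qL// Hd// subset_itv_oo_cc.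
by rewrite pmulr_lle0 ?expR_gt0// le_eqVlt ltNge sqr_ge0 orbF sqrf_eq0 => /eqP.
Qed.

Lemma linear_ode_zero w q (d L : R) :
  (forall x, `|x| < d -> is_derive (x : R) (1 : R) w (q x * w x)) ->
  (forall x, `|x| < d -> `|q x| <= L) -> w 0 = 0 ->
  forall x, `|x| < d -> w x = 0.
Proof.
move=> dw qL w0 x xd; have [x0|x0|<-//] := ltgtP 0 x.
  by apply: (linear_ode_zero_right dw qL w0 x0); rewrite -(gtr0_norm x0).
rewrite -[x]opprK.
apply: (@linear_ode_zero_right (w \o -%R) (fun t => - q (- t)) d L) => [t td|t td|||].
- have ? : is_derive (- t) (1 : R) w (q (- t) * w (- t)) by apply: dw; rewrite normrN.
  have -> : - q (- t) * (w \o -%R) t = (q (- t) * w (- t)) * (- 1) by rewrite /=; ring.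
  exact: is_derive1_comp.
- by rewrite normrN qL// normrN.
- by rewrite /= oppr0.
- by rewrite oppr_gt0.
- by move: xd; rewrite ltr0_norm.
Qed.

(** The list [s k] holds the first k + 1 terms; the hypothesis on [step] allows it to be exchanged
    for the whole sequence. *)
Lemma strong_recursion (a0 : R) (step : nat -> R^nat -> R) :
  (forall k b b', (forall i, (i <= k)%N -> b i = b' i) -> step k b = step k b') ->
  exists a, a 0%N = a0 /\ forall k, a k.+1 = step k a.
Proof.
move=> H.
pose fix s k := if k is k'.+1 then rcons (s k') (step k' (nth 0 (s k'))) else [:: a0].
have ss k : size (s k) = k.+1 by elim: k => //= k IH; rewrite size_rcons IH.
have sn m k : (k <= m)%N -> nth 0 (s m) k = nth 0 (s k) k.
  elim: m => [|m IH]; first by rewrite leqn0 => /eqP ->.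
  rewrite leq_eqVlt => /predU1P[->//|km].
  by rewrite [s m.+1]/= nth_rcons ss ltnS -ltnS km IH.
exists (fun k => nth 0 (s k) k); split=> // k.
rewrite [s k.+1]/= nth_rcons ss ltnn eqxx; apply: H => i ik.
exact: sn.
Qed.

(* The coefficients of the product of a polynomial and a power series. *)
Definition pconv P a (k : nat) : R := \sum_(j < k.+1) P`_j * a (k - j)%N.

Lemma pseries_mulX a x l : pseries a x @ \oo --> l ->
  pseries (fun k => if k is k'.+1 then a k' else 0) x @ \oo --> x * l.
Proof.
move=> al; rewrite -(cvg_shiftn 1)/=.
have -> : (fun n => pseries (fun k => if k is k'.+1 then a k' else 0) x (n + 1)%N)
   = (fun n => x * pseries a x n).
  apply/funext => n; rewrite addn1 /pseries /series/= big_nat_recl// mul0r add0r.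
  by rewrite mulr_sumr; apply: eq_bigr => i _; rewrite exprS; ring.
exact: cvgMr.
Qed.

Lemma pseries_pconv P a x l : pseries a x @ \oo --> l ->
  pseries (pconv P a) x @ \oo --> P.[x] * l.
Proof.
move=> al; elim/poly_ind: P => [|P c IH].
  have -> : pconv 0 a = fun=> 0.
    by apply/funext => k; rewrite /pconv big1// => i _; rewrite coef0 mul0r.
  rewrite horner0 mul0r; apply: cvg_near_cst; near=> n.
  by rewrite /pseries /series/= big1// => i _; rewrite mul0r.
have -> : pseries (pconv (P * 'X + c%:P) a) x =
   (fun n => pseries (fun k => if k is k'.+1 then pconv P a k' else 0) x n + c * pseries a x n).
  apply/funext => n; rewrite /pseries /series/= mulr_sumr -big_split/=.
  apply: eq_bigr => -[|k] _; rewrite /pconv.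
    by rewrite big_ord1 coefD coefMX coefC/= subn0; ring.
  rewrite big_ord_recl coefD coefMX coefC/= subn0 !add0r mulrDl addrC.
  rewrite mulrA; congr (_ * _ + _); congr (_ * _); apply: eq_bigr => i _.
  by rewrite /bump leq0n add1n coefD coefMX coefC/= addr0 subSS.
rewrite hornerMXaddC [_ * x]mulrC mulrDl -mulrA.
by apply: cvgD; [exact: pseries_mulX|exact: cvgMr].
Unshelve. all: by end_near. Qed.

Lemma pseries_poly P x : pseries (fun k => P`_k) x @ \oo --> P.[x].
Proof.
have d0 : pseries (fun k => (k == 0%N)%:R) x @ \oo --> (1 : R).
  apply: cvg_near_cst; near=> n.
  have n0 : (0 < n)%N by near: n; exists 1%N.
  rewrite -(prednK n0) /pseries /series/= big_nat_recl//= big1 ?addr0 ?mulr1//.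
  by move=> i _; rewrite mul0r.
have := @pseries_pconv P _ x 1 d0; rewrite mulr1.
suff -> : pconv P (fun k => (k == 0%N)%:R) = (fun k => P`_k) by [].
apply/funext => k; rewrite /pconv big_ord_recr/= subnn mulr1 big1 ?add0r// => i _.
by rewrite subn_eq0 leqNgt ltn_ord mulr0.
Unshelve. all: by end_near. Qed.

Lemma pseries_geometric a (C p : R) x : 0 < p ->
  (forall k, `|a k| <= C * p ^+ k) -> `|x| < p^-1 -> cvgn (pseries a x).
Proof.
move=> p0 aC xp; apply: normed_cvg; apply: (@series_le_cvg _ _ (geometric C (p * `|x|))).
- by move=> n; exact: normr_ge0.
- move=> n /=; apply: mulr_ge0; last by rewrite exprn_ge0// mulr_ge0// ltW.
  by have := aC 0%N; rewrite expr0 mulr1; apply: le_trans.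
- by move=> n /=; rewrite normrM normrX exprMn mulrA ler_wpM2r ?exprn_ge0.
apply: is_cvg_geometric_series; rewrite ger0_norm ?mulr_ge0 ?(ltW p0)//.
by rewrite mulrC -ltr_pdivlMr ?div1r.
Qed.


Lemma coef_bounded P : exists M, forall j, `|P`_j| <= M.
Proof.
exists (\sum_(i < size P) `|P`_i|) => j.
have [jP|Pj] := ltnP j (size P); last first.
  by rewrite nth_default// normr0 sumr_ge0.
by rewrite (bigD1 (Ordinal jP))//= lerDl sumr_ge0.
Qed.

(** The factor k + 1 is at most 2^k and is absorbed by doubling the ratio. *)
Lemma pseries_diffs_bound a (C p : R) : 0 <= p -> (forall k, `|a k| <= C * p ^+ k) ->
  forall k, `|pseries_diffs a k| <= C * p * (2 * p) ^+ k.
Proof.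
move=> p0 aC k; rewrite /pseries_diffs normrM normr_nat.
have C0 : 0 <= C by have := aC 0%N; rewrite expr0 mulr1; apply: le_trans.
apply: (@le_trans _ _ ((2 ^ k)%:R * (C * p ^+ k.+1))).
  by rewrite ler_pM// ler_nat ltn_expl.
by rewrite natrX exprMn exprS; rewrite le_eqVlt; apply/orP; left; apply/eqP; ring.
Qed.

(** With s_k the sum of the |a_j| for j <= k, the recursion gives |G_0| (k+1) |a_(k+1)| <= M (k+1)
    (s_k + 1). The factors k + 1 coming from derivation cancel, so s_k + 1 grows at most
    geometrically, with ratio 1 + M/|G_0|. *)
Lemma ode_coef_bound (a : R^nat) G A B : G`_0 != 0 ->
  (forall k, pconv G (pseries_diffs a) k = pconv A a k + B`_k) ->
  exists C p : R, 0 < p /\ forall k, `|a k| <= C * p ^+ k.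
Proof.
move=> G0 rec.
have [MA HA] := coef_bounded A; have [MB HB] := coef_bounded B.
have [MG HG] := coef_bounded G.
pose M := MA + MB + MG.
have MA0 : 0 <= MA by apply: le_trans (HA 0%N).
have MB0 : 0 <= MB by apply: le_trans (HB 0%N).
have MG0 : 0 <= MG by apply: le_trans (HG 0%N).
have HA' j : `|A`_j| <= M by apply: le_trans (HA j) _; rewrite /M; lra.
have HB' j : `|B`_j| <= M by apply: le_trans (HB j) _; rewrite /M; lra.
have HG' j : `|G`_j| <= M by apply: le_trans (HG j) _; rewrite /M; lra.
have M0 : 0 <= M by rewrite /M; lra.
pose s k := \sum_(j < k.+1) `|a (k - j)%N|.
have sE k : s k = \sum_(j < k.+1) `|a j|.
  by rewrite [RHS](reindex_inj rev_ord_inj); apply: eq_bigr => j _ /=; rewrite subSS.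
have s0 k : 0 <= s k by apply: sumr_ge0.
have ak k : `|a k.+1| <= M / `|G`_0| * (s k + 1).
  have := rec k; rewrite {1}/pconv big_ord_recl subn0 {1}/pseries_diffs => /eqP.
  rewrite eq_sym -subr_eq => /eqP /esym Ek.
  have Gk : 0 < `|G`_0| * k.+1%:R by rewrite mulr_gt0 ?normr_gt0 ?ltr0n.
  have : `|G`_0| * k.+1%:R * `|a k.+1| <= M * s k + M + M * (k%:R * s k).
    rewrite -{1}[k.+1%:R]normr_nat -!normrM -mulrA Ek.
    apply: (le_trans (ler_normB _ _)); apply: lerD; first apply: (le_trans (ler_normD _ _)); first apply: lerD.
    - apply: (le_trans (ler_norm_sum _ _ _)); rewrite mulr_sumr.
      by apply: ler_sum => j _; rewrite normrM ler_wpM2r.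
    - exact: HB'.
    - apply: (le_trans (ler_norm_sum _ _ _)); rewrite /s big_ord_recr/= mulrDr mulrDr.
      apply: ler_wpDr; first by rewrite !mulr_ge0.
      rewrite !mulr_sumr; apply: ler_sum => j _.
      rewrite normrM /bump leq0n add1n /pseries_diffs subnSK// normrM normr_nat.
      by rewrite ler_pM// ler_wpM2r// ler_nat leq_subr.
  have le2 : M * s k + M + M * (k%:R * s k) <= `|G`_0| * k.+1%:R * (M / `|G`_0| * (s k + 1)).
    have -> : `|G`_0| * k.+1%:R * (M / `|G`_0| * (s k + 1)) = M * k.+1%:R * (s k + 1).
      by field; rewrite normr_eq0.
    have -> : M * k.+1%:R * (s k + 1) = M * s k + M + M * (k%:R * s k) + M * k%:R.
      by rewrite -[k.+1]addn1 natrD; ring.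
    by rewrite lerDl mulr_ge0.
  by move=> /le_trans/(_ le2); rewrite ler_pM2l.
pose m := M / `|G`_0|.
have m0 : 0 <= m by rewrite divr_ge0.
have sk k : s k + 1 <= (`|a 0%N| + 1) * (1 + m) ^+ k.
  elim: k => [|k IH]; first by rewrite sE big_ord1 expr0 mulr1.
  rewrite sE big_ord_recr/= -sE exprSr mulrA.
  apply: (@le_trans _ _ ((s k + 1) * (1 + m))); last first.
    by rewrite ler_wpM2r// addr_ge0.
  by have := ak k; rewrite -/m; lra.
exists (`|a 0%N| + 1), (1 + m); split; first by lra.
move=> k; apply: le_trans (sk k); rewrite sE big_ord_recr/= -addrA ler_wpDl ?sumr_ge0//.
by rewrite lerDl.
Qed.

(** Comparing coefficients in G f' = A f + B determines the series from f(0), because G_0 is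
    nonzero. Its sum S solves the same equation with the same value at 0, and f - S solves the
    homogeneous equation, so it vanishes near 0. *)
Theorem analytic_ode f G A B : G.[0] != 0 ->
  (\forall x \near 0, is_derive (x : R) (1 : R) f ((A.[x] * f x + B.[x]) / G.[x])) ->
  analytic_at f 0.
Proof.
move=> G0 df; have G0' : G`_0 != 0 by rewrite -horner_coef0.
pose step k (b : R^nat) := (\sum_(j < k.+1) A`_j * b (k - j)%N + B`_k -
  \sum_(j < k) G`_j.+1 * ((k - j)%:R * b (k - j)%N)) / (G`_0 * k.+1%:R).
have [a [a0 ar]] : exists a, a 0%N = f 0 /\ forall k, a k.+1 = step k a.
  apply: strong_recursion => k b b' bb'; congr ((_ + _ - _) / _).
    by apply: eq_bigr => j _; rewrite bb'// leq_subr.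
  by apply: eq_bigr => j _; rewrite bb'// leq_subr.
have rec k : pconv G (pseries_diffs a) k = pconv A a k + B`_k.
  rewrite {1}/pconv big_ord_recl subn0 {1}/pseries_diffs ar /step mulrA.
  rewrite mulrC divfK ?mulf_neq0 ?pnatr_eq0//.
  rewrite [X in _ + X](_ : _ = \sum_(j < k) G`_j.+1 * ((k - j)%:R * a (k - j)%N)) ?subrK//.
  by apply: eq_bigr => j _; rewrite lift0 /pseries_diffs subnSK.
have [C [p [p0 aC]]] := ode_coef_bound G0' rec.
have dC := pseries_diffs_bound (ltW p0) aC.
have p2 : 0 < 2 * p by lra.
have ddC := pseries_diffs_bound (ltW p2) dC.
have p4 : 0 < 2 * (2 * p) by lra.
(* Termwise derivation by [pseries_snd_diffs] asks for convergence of the twice derived series,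
   whose ratio is 4p; 8p makes the inequality strict. *)
pose K := (8 * p)^-1.
have K0 : 0 < K by rewrite invr_gt0; lra.
have nK : `|K| = K by rewrite gtr0_norm.
have Kp4 : `|K| < (2 * (2 * p))^-1 by rewrite nK ltf_pV2 ?posrE; lra.
have Kp2 : `|K| < (2 * p)^-1 by apply: lt_le_trans Kp4 _; rewrite lef_pV2 ?posrE; lra.
have Kp : `|K| < p^-1 by apply: lt_le_trans Kp2 _; rewrite lef_pV2 ?posrE; lra.
pose S x := limn (pseries a x); pose S' x := limn (pseries (pseries_diffs a) x).
have Sx x : `|x| < K -> pseries a x @ \oo --> S x.
  by move=> xK; apply: pseries_geometric p0 aC _; apply: lt_trans Kp; rewrite nK.
have S'x x : `|x| < K -> pseries (pseries_diffs a) x @ \oo --> S' x.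
  by move=> xK; apply: pseries_geometric p2 dC _; apply: lt_trans Kp2; rewrite nK.
have dS x : `|x| < K -> is_derive (x : R) (1 : R) S (S' x).
  move=> xK; apply: (@pseries_snd_diffs _ a K x); last by rewrite nK.
  - exact: pseries_geometric p0 aC _.
  - exact: pseries_geometric p2 dC _.
  - exact: pseries_geometric p4 ddC _.
have odeS x : `|x| < K -> G.[x] * S' x = A.[x] * S x + B.[x].
  move=> xK; have h1 := @pseries_pconv G _ _ _ (S'x x xK).
  have h2 := cvgD (@pseries_pconv A _ _ _ (Sx x xK)) (@pseries_poly B x).
  have e12 : pseries (pconv G (pseries_diffs a)) x =
      pseries (pconv A a) x + pseries (fun k => B`_k) x.
    apply/funext => n; rewrite /pseries /series/= fctE -big_split/=.
    by apply: eq_bigr => i _; rewrite rec mulrDl.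
  rewrite e12 in h1; have := cvg_unique (@Rhausdorff R) h1 (h2 _); apply.
have S0 : S 0 = f 0.
  apply: (cvg_unique (@Rhausdorff R) (Sx 0 _)); first by rewrite normr0.
  apply: cvg_near_cst; near=> n.
  have n0 : (0 < n)%N by near: n; exists 1%N.
  rewrite -(prednK n0) /pseries /series/= big_nat_recl// expr0 mulr1 a0 big1 ?addr0//.
  by move=> i _; rewrite expr0n mulr0.
have cq : (fun x => A.[x] / G.[x]) x @[x --> 0] --> A.[0] / G.[0].
  by apply: cvgM; [|apply: cvgV => //]; exact: continuous_horner.
have bq : \forall x \near 0, `|A.[x] / G.[x]| <= `|A.[0] / G.[0]| + 1.
  near=> x.
  have : `|A.[0] / G.[0] - A.[x] / G.[x]| < 1 by near: x; exact: (cvgr_dist_lt _ _ cq).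
  rewrite distrC => h; have := ler_normD (A.[0] / G.[0]) (A.[x] / G.[x] - A.[0] / G.[0]).
  by rewrite addrC subrK => /le_trans; apply; rewrite lerD2l ltW.
have nG : \forall x \near (0 : R), G.[x] != 0.
  by apply: (@cvgr_neq0 _ _ _ (nbhs (0:R)) _ (horner G) G.[0]) => //; exact: continuous_horner.
have xK : \forall x \near (0 : R), `|x| < K.
  by apply/nbhs_ballP; exists K => // x; rewrite -ball_normE/= sub0r normrN.
have /nbhs_ballP[d /= d0 Hd] : \forall x \near (0 : R),
    [/\ is_derive (x : R) (1 : R) f ((A.[x] * f x + B.[x]) / G.[x]),
       `|A.[x] / G.[x]| <= `|A.[0] / G.[0]| + 1, G.[x] != 0 & `|x| < K].
  by near do split.
have Hd' x (xd : `|x| < d) := Hd x (ltac:(by rewrite -ball_normE/= sub0r normrN)).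
exists a; apply/nbhs_ballP; exists d => //= x.
rewrite -ball_normE/= sub0r normrN subr0 => xd.
have -> : f x = S x.
  apply/eqP; rewrite -subr_eq0; apply/eqP.
  apply: (@linear_ode_zero (fun x => f x - S x) (fun x => A.[x] / G.[x]) d
    (`|A.[0] / G.[0]| + 1)) => // [y /Hd'[fy _ Gy yK]|y /Hd'[]//|].
    have ? := dS y yK; apply: is_derive_eq.
    by have <- : (A.[y] * S y + B.[y]) / G.[y] = S' y;
      [rewrite -odeS// mulrC mulKf|field].
  by rewrite S0 subrr.
by apply: Sx; have [] := Hd' x xd.
Unshelve. all: by end_near. Qed.

End ODE.

(** * Roots of h_e near the roots of Q *)

Section Clusters.
Variable R : realType.

(** The neighbourhood of e may depend on d, so a single choice has to serve all tolerances at
    once. *)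
Lemma near_selection (P : R -> R -> Prop) (l : R) :
  (forall d, 0 < d -> \forall e \near 0^', exists z, `|z - l| <= d /\ P e z) ->
  exists f : R -> R, (\forall e \near 0^', P e (f e)) /\ f e @[e --> 0^'] --> l.
Proof.
move=> HP.
pose D e := [set `|z - l| | z in P e].
have Dlb e : has_lbound (D e) by exists 0 => _ [z _ <-].
(* A point of P e whose distance to l is minimal up to |e|. *)
pose f e := xget l [set z | P e z /\ `|z - l| < inf (D e) + `|e|].
have Hf e : e != 0 -> P e !=set0 -> P e (f e) /\ `|f e - l| < inf (D e) + `|e|.
  move=> e0 [z Pz]; apply: (@xgetPex _ l [set z | P e z /\ `|z - l| < inf (D e) + `|e|]).
  have e0' : 0 < `|e| by rewrite normr_gt0.
  have [] := @inf_adherent _ (D e) _ e0'; first by split => //; exists `|z - l|, z.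
  by move=> _ [y Py <-] yl; exists y.
exists f; split.
  near=> e; apply: (Hf e _ _).1; first by near: e; exact: nbhs_dnbhs_neq.
  have [z [_ Pz]] : exists z, `|z - l| <= 1 /\ P e z by near: e; exact: HP.
  by exists z.
apply/cvgrPdist_le => d d0; near=> e.
have [z [zl Pz]] : exists z, `|z - l| <= d / 2 /\ P e z.
  by near: e; apply: HP; rewrite divr_gt0.
have e0 : e != 0 by near: e; exact: nbhs_dnbhs_neq.
have ed : `|e| < d / 2 by near: e; apply: dnbhs0_lt; rewrite divr_gt0.
have [|_ fl] := Hf e e0; first by exists z.
rewrite distrC; have : inf (D e) <= `|z - l| by apply: ge_inf => //; exists z.
lra.
Unshelve. all: by end_near. Qed.

Lemma poly_ivt_neg (p : {poly R}) a b : a <= b -> p.[a] * p.[b] < 0 ->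
  exists2 x, a <= x <= b & root p x.
Proof.
move=> ab pab; have [pa|pa] := lerP p.[a] 0.
  apply: Num.poly_ivt => //; rewrite pa/= ltW//.
  by rewrite ltNge; apply: contraTN pab => pb; rewrite -leNgt mulr_le0.
have /(Num.poly_ivt ab)[x xab] : (- p).[a] <= 0 <= (- p).[b].
  rewrite !hornerN !oppr_le0 !oppr_ge0 (ltW pa)/= leNgt.
  by apply: contraTN pab => pb; rewrite -leNgt mulr_ge0// ltW.
by rewrite rootN; exists x.
Qed.

(** Q is (X - lam i) q with q of constant sign at lam i - t and lam i + t for a suitable small t, so
    Q changes sign between them. Only these two points are probed, which is why the pointwise limits
    in [zooms_to] suffice. *)
Lemma zooms_to_root n (alpha beta u v : 'rV[R]_n) c r Q (lam : 'I_r -> R) :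
  injective lam -> Q = \prod_i ('X - (lam i)%:P) -> zooms_to alpha beta u v c r Q ->
  forall i, exists f : R -> R,
    (\forall e \near 0^', root (h_poly alpha beta u v e) (c + e * f e)) /\
    f e @[e --> 0^'] --> lam i.
Proof.
move=> il Ql [K K0 HK] i; set h := h_poly alpha beta u v.
apply: (@near_selection (fun e z => root (h e) (c + e * z))) => d d0.
pose q := \prod_(j | j != i) ('X - (lam j)%:P).
have qi : q.[lam i] != 0.
  rewrite horner_prod; apply/prodf_neq0 => j ji.
  by rewrite hornerXsubC subr_eq0 (inj_eq il) eq_sym.
have Qq x : Q.[lam i + x] = x * q.[lam i + x].
  by rewrite Ql (bigD1 i)//= hornerM hornerXsubC addrC addKr.
have qq : q.[lam i + x] * q.[lam i - x] @[x --> 0^'] --> q.[lam i] * q.[lam i].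
  have := @polyfun_cvg _ (fun x => q.[lam i + x] * q.[lam i - x]).
  rewrite addr0 subr0; apply; apply: polyfunM.
    by apply: polyfun_horner (polyfam_cst _) (polyfunD (polyfun_cst _) (polyfun_id _)).
  by apply: polyfun_horner (polyfam_cst _) (polyfunD (polyfun_cst _) (polyfunN (polyfun_id _))).
have [t [t0 td qt]] : exists t, [/\ 0 < t, t <= d & 0 < q.[lam i + t] * q.[lam i - t]].
  apply: (@filter_ex _ (0^'+ : set_system R)); near=> t; split; near: t.
  - exact: nbhs_right_gt.
  - exact: nbhs_right_le.
  - by apply: (cvgr_gt _ (cvg_dnbhs_at_right qq)); rewrite -expr2 exprn_even_gt0.
have [W1 [pW1 W10 hW1]] := HK (lam i - t).
have [W2 [pW2 W20 hW2]] := HK (lam i + t).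
have W12 : W1 0 * W2 0 < 0.
  rewrite W10 W20 !Qq.
  have -> : K * (- t * q.[lam i - t]) * (K * (t * q.[lam i + t])) =
     - ((K * t) ^+ 2 * (q.[lam i + t] * q.[lam i - t])) by ring.
  by rewrite oppr_lt0 mulr_gt0// exprn_even_gt0//= mulf_neq0// gt_eqF.
near=> e.
have e0 : e != 0 by near: e; exact: nbhs_dnbhs_neq.
have W12e : W1 e * W2 e < 0.
  by near: e; apply: (cvgr_lt _ _ _ W12); exact: cvgM (polyfun_cvg pW1) (polyfun_cvg pW2).
have := @poly_ivt_neg (h e \Po (c%:P + e *: 'X)) (lam i - t) (lam i + t).
case; first by lra.
  rewrite !horner_comp !hornerD !hornerZ !hornerX !hornerC hW1// hW2//.
  by rewrite mulrACA -expr2 pmulr_rlt0 ?W12e// exprn_even_gt0//= expf_neq0.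
move=> z ztd; rewrite /root horner_comp hornerD hornerZ hornerX hornerC => hz.
by exists z; split=> //; rewrite ler_norml; lra.
Unshelve. all: by end_near. Qed.

End Clusters.

(** * Limits of symmetric functions of clustered roots *)

Section Limits.
Variable R : realType.

Lemma cvg_sumr (I : finType) (P : pred I) (F : I -> R -> R) (a : I -> R) :
  (forall i, P i -> F i e @[e --> 0^'] --> a i) ->
  \sum_(i | P i) F i e @[e --> 0^'] --> \sum_(i | P i) a i.
Proof. by move=> Fa; apply: cvg_big => //; exact: add_continuous. Qed.

Lemma cvg_prodr (I : finType) (P : pred I) (F : I -> R -> R) (a : I -> R) :
  (forall i, P i -> F i e @[e --> 0^'] --> a i) ->
  \prod_(i | P i) F i e @[e --> 0^'] --> \prod_(i | P i) a i.
Proof. by move=> Fa; apply: cvg_big => //; exact: mul_continuous. Qed.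

Lemma cvg_dnbhs0_near (f g : R -> R) l : (\forall e \near 0^', f e = g e) ->
  f e @[e --> 0^'] --> (l : R) -> g e @[e --> 0^'] --> (l : R).
Proof. by move=> fg; apply: cvg_trans; exact: near_eq_cvg. Qed.

Lemma cvg_dnbhs0_eq (f g : R -> R) l : (forall e, e != 0 -> f e = g e) ->
  f e @[e --> 0^'] --> (l : R) -> g e @[e --> 0^'] --> (l : R).
Proof.
move=> fg; apply: cvg_dnbhs0_near; near=> e; apply: fg.
by near: e; exact: nbhs_dnbhs_neq.
Unshelve. all: by end_near. Qed.

Lemma cvg_dnbhs0_id : (fun e : R => e) e @[e --> 0^'] --> (0 : R).
Proof. exact: (polyfun_cvg (@polyfun_id R)). Qed.

(** If P/e^(m+1) converges, then P/e^m tends to 0, so the quotient found at stage m vanishes at 0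
    and yields one more factor X. *)
Lemma poly_div_limit (P : {poly R}) m g : P.[e] / e ^+ m @[e --> 0^'] --> g ->
  exists2 G : {poly R}, P = G * 'X^m & G.[0] = g.
Proof.
have cont (G : {poly R}) l : G.[e] @[e --> 0^'] --> l -> G.[0] = l.
  move=> Gl; apply: (cvg_unique (@Rhausdorff R) _ Gl).
  by apply: (@polyfun_cvg R (fun e => G.[e])); exists G.
elim: m g => [|m IH] g Pg.
  exists P; first by rewrite expr0 mulr1.
  by apply: cont; move: Pg; under eq_fun do rewrite expr0 divr1.
have Pm0 : P.[e] / e ^+ m @[e --> 0^'] --> (0 : R).
  rewrite -[X in _ --> X](mul0r g).
  apply: (cvg_dnbhs0_eq _ (cvgM cvg_dnbhs0_id Pg)) => e e0.
  by rewrite exprS /=; field; rewrite e0/= expf_neq0.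
have [G PG G0] := IH _ Pm0.
have /factor_theorem[H GH] : root G 0 by rewrite /root G0.
exists H; first by rewrite PG GH subr0 -mulrA -exprS.
apply: cont; apply: (cvg_dnbhs0_eq _ Pg) => e e0.
by rewrite PG GH subr0 !hornerM hornerX hornerXn exprS; field; rewrite e0/= expf_neq0.
Qed.

Lemma ln_prod_pairs (T : finType) (g : T -> T -> R) : (forall s t, t != s -> g s t != 0) ->
  ln `|\prod_s \prod_(t | t != s) g s t| = \sum_s \sum_(t | t != s) ln `|g s t|.
Proof.
move=> g0; rewrite normr_prod ln_prodr => [|s _]; last first.
  by rewrite normr_gt0; apply/prodf_neq0 => t; exact: g0.
apply: eq_bigr => s _; rewrite normr_prod ln_prodr// => t ts.
by rewrite normr_gt0 g0.
Qed.

Lemma log_sumE (T : finType) (x : T -> R) :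
  log_sum x = \sum_s \sum_(t | t != s) ln `|x s - x t|.
Proof.
by apply: eq_bigr => s _; rewrite (bigD1 s)//= subrr normr0 ln0// add0r.
Qed.

Lemma sym_polyfun_fin (T : finType) m (p : R -> {poly R}) : #|T| = m.+1 -> polyfam p ->
  exists P N : R -> R, [/\ polyfun P, polyfun N &
    forall e (x : T -> R), injective x -> p e = \prod_t ('X - (x t)%:P) ->
    P e = \prod_t \prod_(s | s != t) (x t - x s) /\ N e = 4 * P e ^+ 2 * score_sum x].
Proof.
move=> cT /(sym_polyfun m)[P [N [pP pN H]]]; exists P, N; split=> // e x ix px.
pose g := fun i : 'I_m.+1 => enum_val (cast_ord (esym cT) i) : T.
have gb : {on predT, bijective g}.
  exists (fun t => cast_ord cT (enum_rank t)) => t _; rewrite /g.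
    by rewrite enum_valK cast_ordKV.
  by rewrite cast_ordK enum_rankK.
have re (U : Type) (idx : U) (op : Monoid.com_law idx) (F : T -> U) :
    \big[op/idx]_t F t = \big[op/idx]_i F (g i) by rewrite (reindex g).
have ig : injective (x \o g).
  by apply: inj_comp => // i j /enum_val_inj/cast_ord_inj.
have [] := H e (x \o g) ig; first by rewrite px re.
move=> -> ->; split.
  by rewrite [RHS]re; apply: eq_bigr => i _; rewrite px horner_deriv_root.
congr (_ * _); rewrite /score_sum [RHS]re; apply: eq_bigr => i _.
by rewrite [in RHS]re.
Qed.

(* The clustered roots C t + e f_t(e), where f_t(e) tends to L t. *)
Variables (T : finType) (C L : T -> R) (f : T -> R -> R).
Hypotheses (CL : forall s t, s != t -> C s = C t -> L s != L t)
  (fL : forall t, f t e @[e --> 0^'] --> L t).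

Let x e t := C t + e * f t e.
(** The leading coefficient of [x e s - x e t], whose order in e is the boolean [C s == C t] read as
    0 or 1. *)
Definition gap s t : R := if C s == C t then L s - L t else C s - C t.

Lemma gap_neq0 s t : t != s -> gap s t != 0.
Proof.
rewrite /gap => ts; case: (C s =P C t) => [st|/eqP]; last by rewrite subr_eq0.
by rewrite subr_eq0 CL// eq_sym.
Qed.

Lemma gap_cvg s t : (x e s - x e t) / e ^+ (C s == C t) @[e --> 0^'] --> gap s t.
Proof.
rewrite /gap; case: (C s =P C t) => st.
  apply: (cvg_dnbhs0_eq _ (cvgB (@fL s) (@fL t))) => e e0.
  by rewrite -[LHS]/(f s e - f t e) /x st expr1; field.
have xs u : x e u @[e --> 0^'] --> C u.
  rewrite -[X in _ --> X]addr0 -[X in _ + X](mul0r (L u)).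
  apply: cvgD; first exact: cvg_cst.
  exact: (cvgM cvg_dnbhs0_id (@fL u)).
by under eq_fun do rewrite expr0 divr1; exact: cvgB.
Qed.

Lemma near_injective : \forall e \near 0^', injective (x e).
Proof.
have : \forall e \near 0^', forall s, true -> forall t, t != s ->
    (x e s - x e t) / e ^+ (C s == C t) != 0.
  apply: filter_forall => s; near do move=> _; apply: filter_forall => t.
  have [ts|ts] := boolP (t != s); last by near=> e.
  by near do move=> _; apply: (cvgr_neq0 _ (@gap_cvg s t)); exact: gap_neq0.
apply: filterS => e H s t st; apply/eqP; rewrite eq_sym; apply: contraT => ts.
by have := H s isT t ts; rewrite st subrr mul0r eqxx.
Unshelve. all: by end_near. Qed.

(** Both run over ordered pairs, so that for the clusters of h_0 the absolute value of [gap_prod] is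
    D_* and [gap_count] is M. *)
Definition gap_prod : R := \prod_s \prod_(t | t != s) gap s t.
Definition gap_count : nat := \sum_s \sum_(t | t != s) (C s == C t).

Lemma gap_prod_cvg :
  (\prod_s \prod_(t | t != s) (x e s - x e t)) / e ^+ gap_count @[e --> 0^'] --> gap_prod.
Proof.
have -> : (fun e => (\prod_s \prod_(t | t != s) (x e s - x e t)) / e ^+ gap_count) =
    (fun e => \prod_s \prod_(t | t != s) ((x e s - x e t) / e ^+ (C s == C t))).
  apply/funext => e; rewrite /gap_count expr_sum -prodf_div; apply: eq_bigr => s _.
  by rewrite expr_sum -prodf_div.
by apply: cvg_prodr => s _; apply: cvg_prodr => t _; exact: gap_cvg.
Qed.

(** After multiplication by e^2 only pairs inside a cluster survive; the diagonal term is 0^-1 =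
    0. *)
Definition gap_score : R := \sum_s (\sum_(t | C t == C s) (L s - L t)^-1) ^+ 2.

Lemma gap_score_cvg : e ^+ 2 * score_sum (x e) @[e --> 0^'] --> gap_score.
Proof.
have -> : (fun e => e ^+ 2 * score_sum (x e)) =
    (fun e => \sum_s (\sum_t e / (x e s - x e t)) ^+ 2).
  apply/funext => e; rewrite mulr_sumr; apply: eq_bigr => s _.
  by rewrite -exprMn mulr_sumr.
apply: cvg_sumr => s _; under eq_fun do rewrite expr2.
rewrite expr2; suff H : \sum_t e / (x e s - x e t) @[e --> 0^'] --> \sum_(t | C t == C s) (L s - L t)^-1.
  exact: cvgM.
rewrite [X in _ --> X]big_mkcond; apply: cvg_sumr => t _.
have [->|ts] := eqVneq t s.
  under eq_fun do rewrite subrr invr0 mulr0.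
  by rewrite eqxx subrr invr0; exact: cvg_cst.
have gst := gap_neq0 ts; have := cvgV gst (@gap_cvg s t); rewrite /gap [C t == _]eq_sym.
case: (C s =P C t) => st H.
  by apply: (cvg_dnbhs0_eq _ (H _)) => e _; rewrite /= invfM invrK expr1 mulrC.
rewrite -[X in _ --> X](mul0r (C s - C t)^-1).
apply: (cvg_dnbhs0_eq _ (cvgM cvg_dnbhs0_id (H _))) => e _.
by rewrite -[LHS]/(e * ((x e s - x e t) / e ^+ false)^-1) expr0 divr1.
Qed.

End Limits.

(** * Expansion at 0 *)

Section Expansion.
Variable R : realType.

(** The product P of all differences over ordered pairs is, up to sign, the discriminant. It is
    polynomial in e, equal to e^M times a factor tending to [gap_prod], where M is [gap_count].
    Dividing 4 P^2 |s|^2 by the matching power of e expresses e^2 |s|^2 as a quotient with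
    denominator G^2. *)
Lemma cluster_expansion (T : finType) (C L : T -> R) (f : T -> R -> R) m (p : R -> {poly R}) :
  (forall s t, s != t -> C s = C t -> L s != L t) ->
  (forall t, f t e @[e --> 0^'] --> L t) ->
  #|T| = m.+1 -> polyfam p ->
  (\forall e \near 0^', p e = \prod_t ('X - (C t + e * f t e)%:P)) ->
  exists G N : {poly R}, [/\ 0 < G.[0], G.[0] = `|gap_prod C L|,
    N.[0] / (G ^+ 2).[0] = gap_score C L &
    \forall e \near 0^', [/\ injective (fun t => C t + e * f t e),
      log_sum (fun t => C t + e * f t e) = (gap_count C)%:R * ln `|e| + ln G.[e] &
      e ^+ 2 * score_sum (fun t => C t + e * f t e) = N.[e] / (G ^+ 2).[e]]].
Proof.
move=> CL fL cT pp px; set x := fun e t => C t + e * f t e.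
have [P' [N' [[P PE] [N NE] PN]]] := sym_polyfun_fin cT pp.
have PNx : \forall e \near 0^', injective (x e) /\
    (P.[e] = \prod_t \prod_(s | s != t) (x e t - x e s) /\
     N.[e] = 4 * P.[e] ^+ 2 * score_sum (x e)).
  have ix := near_injective CL fL.
  near=> e; have ixe : injective (x e) by near: e.
  by split=> //; rewrite -PE -NE; apply: PN => //; near: e.
have [G0 PG0 G00] : exists2 G : {poly R}, P = G * 'X^(gap_count C) & G.[0] = gap_prod C L.
  apply: poly_div_limit; apply: (cvg_dnbhs0_near _ (@gap_prod_cvg _ _ C L f fL)).
  by apply: filterS PNx => e [_ [-> _]].
have gp0 : gap_prod C L != 0.
  by apply/prodf_neq0 => s _; apply/prodf_neq0 => t ts; exact: gap_neq0.
have G0n : \forall e \near 0^', G0.[e] != 0.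
  apply: (@cvgr_neq0 _ _ _ _ _ (horner G0) G0.[0]); last by rewrite G00.
  exact/continuous_withinNx/continuous_horner.
have lim4 : 4 * G0.[e] ^+ 2 * (e ^+ 2 * score_sum (x e)) @[e --> 0^'] -->
    4 * gap_prod C L ^+ 2 * gap_score C L.
  have H : 4 * G0.[e] ^+ 2 @[e --> 0^'] --> 4 * gap_prod C L ^+ 2.
    rewrite -G00; apply: (@polyfun_cvg R (fun e => 4 * G0.[e] ^+ 2)).
    by apply: polyfunM (polyfun_cst _) _; apply: polyfunX; exists G0.
  exact: (cvgM H (gap_score_cvg CL fL)).
(* Multiplying by X^2 avoids the exponent 2M - 2, which natural subtraction would truncate when M =
   0. *)
have [N1 NN1 N10] : exists2 N1 : {poly R}, N * 'X^2 = N1 * 'X^(gap_count C * 2) &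
    N1.[0] = 4 * gap_prod C L ^+ 2 * gap_score C L.
  apply: poly_div_limit; apply: (cvg_dnbhs0_near _ lim4); near=> e.
  have e0 : e != 0 by near: e; exact: nbhs_dnbhs_neq.
  have [_ [_ NP]] : injective (x e) /\
    (P.[e] = \prod_t \prod_(s | s != t) (x e t - x e s) /\
     N.[e] = 4 * P.[e] ^+ 2 * score_sum (x e)) by near: e.
  rewrite hornerM hornerXn NP PG0 hornerM hornerXn exprM.
  by field; rewrite expf_neq0.
(* The sign of [gap_prod] is moved into G to get G(0) > 0; G^2 is unaffected because sg^2 = 1. *)
pose sg := Num.sg (gap_prod C L).
have sg2 : sg ^+ 2 = 1 by rewrite sqr_sg gp0.
pose G := sg *: G0.
have GE : G.[0] = `|gap_prod C L| by rewrite hornerZ G00 normrEsg.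
have G0' : 0 < G.[0] by rewrite GE normr_gt0.
exists G, (4^-1 *: N1); split=> //.
  rewrite hornerZ N10 horner_exp GE real_normK ?num_real//.
  by field.
near=> e.
have e0 : e != 0 by near: e; exact: nbhs_dnbhs_neq.
have [ix [PEe NP]] : injective (x e) /\
    (P.[e] = \prod_t \prod_(s | s != t) (x e t - x e s) /\
     N.[e] = 4 * P.[e] ^+ 2 * score_sum (x e)) by near: e.
have G0e : G0.[e] != 0 by near: e.
have Ge : 0 < G.[e].
  near: e; apply: (@cvgr_gt _ _ _ _ (horner G) G.[0]) => //.
  exact/continuous_withinNx/continuous_horner.
have GnE : G.[e] = `|G0.[e]|.
  rewrite -[LHS]gtr0_norm// hornerZ normrM normr_sg gp0 mul1r//.
split=> //.
- rewrite log_sumE -(@ln_prod_pairs _ _ (fun s t => x e s - x e t)) => [|s t ts]; last first.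
    by rewrite subr_eq0 (inj_eq ix) eq_sym.
  rewrite -PEe PG0 hornerM hornerXn normrM normrX GnE mulrC lnM ?posrE ?exprn_gt0 ?normr_gt0//.
  by rewrite lnXn ?normr_gt0// mulr_natl.
- have : (N * 'X^2).[e] = (N1 * 'X^(gap_count C * 2)).[e] by rewrite NN1.
  rewrite [LHS]hornerM [RHS]hornerM !hornerXn NP PG0 hornerM hornerXn exprM => H.
  have em : e ^+ gap_count C != 0 by rewrite expf_neq0.
  rewrite hornerZ horner_exp hornerZ exprMn sg2 mul1r.
  apply: (mulIf (expf_neq0 2 em)).
  transitivity (4^-1 * (N1.[e] * e ^+ gap_count C ^+ 2) / G0.[e] ^+ 2); last by field.
  by rewrite -H; field; rewrite G0e.
Unshelve. all: by end_near. Qed.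

(** The equation also provides a derivative at 0, and a bound on the difference quotients there is
    the O(|e|) remainder. *)
Lemma analytic_ode_bigO (f : R -> R) (G A B : {poly R}) : G.[0] != 0 ->
  (\forall x \near 0, is_derive (x : R) (1 : R) f ((A.[x] * f x + B.[x]) / G.[x])) ->
  analytic_at f 0 /\ (fun e => f e - f 0) =O_ (0^') (fun e => `|e|).
Proof.
move=> G0 df; split; first exact: analytic_ode df.
have [+ _] : is_derive (0 : R) (1 : R) f ((A.[0] * f 0 + B.[0]) / G.[0]) by exact: nbhs_singleton df.
rewrite /derivable => /cvg_ex[l fl].
apply/eqO_exP; exists (`|l| + 1); first by rewrite ltr_wpDl.
near=> e.
have e0 : e != 0 by near: e; exact: nbhs_dnbhs_neq.
have H : `|l - e^-1 *: (f (e *: 1 + 0) - f 0)| < 1 by near: e; exact: (cvgr_dist_lt _ _ fl).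
have {H} : `|e^-1 * (f e - f 0)| <= `|l| + 1.
  move: H; rewrite addr0 [e *: 1]mulr1 [_ *: _]/(_ * _) distrC => H.
  have := ler_normD l (e^-1 * (f e - f 0) - l); rewrite addrC subrK => /le_trans; apply.
  by rewrite lerD2l ltW.
by rewrite normrM normfV mulrC ler_pdivrMr ?normr_gt0// normr_id.
Unshelve. all: by end_near. Qed.

Lemma near_horner_gt0 (G : {poly R}) : 0 < G.[0] -> \forall e \near 0, 0 < G.[e].
Proof.
move=> G0; have H : horner G e @[e --> (0 : R)] --> G.[0] by exact: continuous_horner.
exact: (cvgr_gt _ H).
Qed.

Lemma analytic_ln (G : {poly R}) a : 0 < G.[0] ->
  analytic_at (fun e => a * ln G.[e]) 0 /\
  (fun e => a * ln G.[e] - a * ln G.[0]) =O_ (0^') (fun e => `|e|).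
Proof.
move=> G0; apply: (@analytic_ode_bigO _ G 0 (a *: G^`())); first by rewrite gt_eqF.
near=> x; have Gx : 0 < G.[x] by near: x; exact: near_horner_gt0.
have dG := is_derive_poly G x; have dl := is_derive1_ln Gx.
have dlG := is_derive1_comp dl dG.
rewrite horner0 mul0r add0r hornerZ.
have -> : a * G^`().[x] / G.[x] = a * (G.[x]^-1 * G^`().[x]) by field; rewrite gt_eqF.
exact: (is_deriveZ a dlG).
Unshelve. all: by end_near. Qed.

(** This is the power G^a, a solution of G f' = a G' f. *)
Lemma analytic_exp_ln (G : {poly R}) a : 0 < G.[0] ->
  analytic_at (fun e => expR (a * ln G.[e])) 0 /\
  (fun e => expR (a * ln G.[e]) - expR (a * ln G.[0])) =O_ (0^') (fun e => `|e|).
Proof.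
move=> G0; apply: (@analytic_ode_bigO _ G (a *: G^`()) 0); first by rewrite gt_eqF.
near=> x; have Gx : 0 < G.[x] by near: x; exact: near_horner_gt0.
have dG := is_derive_poly G x; have dl := is_derive1_ln Gx.
have dlG := is_derive1_comp dl dG.
have dal : is_derive (x : R) (1 : R) (fun e => a * ln G.[e]) (a * (G.[x]^-1 * G^`().[x])).
  exact: (is_deriveZ a dlG).
have de := is_derive_expR (a * ln G.[x]).
have -> : (fun e => expR (a * ln G.[e])) = expR \o (fun e => a * ln G.[e]) by [].
rewrite horner0 addr0 hornerZ.
have -> : a * G^`().[x] * expR (a * ln G.[x]) / G.[x] =
  expR (a * ln G.[x]) * (a * (G.[x]^-1 * G^`().[x])) by field; rewrite gt_eqF.
exact: (@is_derive1_comp R expR (fun e => a * ln G.[e]) x _ _ de dal).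
Unshelve. all: by end_near. Qed.

(** Differentiating D f = a N gives D f' = - D' f + a N'. *)
Lemma analytic_div (N D : {poly R}) a : D.[0] != 0 ->
  analytic_at (fun e => a * (N.[e] / D.[e])) 0 /\
  (fun e => a * (N.[e] / D.[e]) - a * (N.[0] / D.[0])) =O_ (0^') (fun e => `|e|).
Proof.
move=> D0; apply: (@analytic_ode_bigO _ D (- D^`()) (a *: N^`())) => //.
have H : horner D e @[e --> (0 : R)] --> D.[0] by exact: continuous_horner.
near=> x; have Dx : D.[x] != 0.
  by near: x; exact: (cvgr_neq0 _ H).
have dN := is_derive_poly N x; have dD := is_derive_poly D x.
have dV := is_deriveV Dx.
have -> : (fun e => a * (N.[e] / D.[e])) = a \*: (horner N \* (fun y => (D.[y])^-1)) by [].
apply: is_derive_eq; rewrite hornerN hornerZ /GRing.scale /=.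
by field.
Unshelve. all: by end_near. Qed.

End Expansion.

(** * Sums over the clusters *)

Section ClusterSums.
Variables (R : realType) (kappa : nat) (c : 'I_kappa -> R) (r : 'I_kappa -> nat).
Variable lam : forall l, 'I_(r l) -> R.
Hypotheses (ic : injective c) (il : forall l, injective (@lam l)).

Local Notation T := {l : 'I_kappa & 'I_(r l)}.
Let C (t : T) := c (tag t).
Let L (t : T) := lam (tagged t).

Lemma sum_tagged (F : T -> R) : \sum_t F t = \sum_l \sum_(i < r l) F (Tagged (fun l => 'I_(r l)) i).
Proof.
rewrite (sig_big_dep xpredT (fun=> xpredT) (fun l i => F (Tagged (fun l => 'I_(r l)) i)))/=.
by apply: eq_bigr => -[l i].
Qed.

Lemma card_tagged_ord : #|{: T}| = (\sum_(l < kappa) r l)%N.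
Proof.
rewrite card_tagged sumnE big_map big_enum.
by apply: eq_bigr => l _; rewrite card_ord.
Qed.

Lemma sum_cluster l (F : T -> R) :
  \sum_t (if C t == c l then F t else 0) = \sum_(i < r l) F (Tagged (fun l => 'I_(r l)) i).
Proof.
rewrite sum_tagged (bigD1 l)//= [X in _ + X]big1 ?addr0 => [|l' ll'].
  by apply: eq_bigr => i _; rewrite /C/= eqxx.
by apply: big1 => i _; rewrite /C/= (inj_eq ic) (negPf ll').
Qed.

Lemma tagged_separated s t : s != t -> C s = C t -> L s != L t.
Proof.
case: s t => [l i] [l' j] + /ic/= ll'; case: _ / ll' j => j.
by apply: contraNneq => /il /= ->.
Qed.

Lemma gap_count_clusters : (gap_count C)%:R = \sum_l (r l)%:R * ((r l)%:R - 1) :> R.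
Proof.
rewrite natr_sum sum_tagged; apply: eq_bigr => l _.
transitivity (\sum_(i < r l) ((r l)%:R - 1) : R); last by rewrite sumr_const card_ord mulr_natl.
apply: eq_bigr => i _; rewrite natr_sum.
have -> : (r l)%:R = \sum_t (C t == c l)%:R :> R.
  transitivity (\sum_t (if C t == c l then 1 else 0) : R).
    by rewrite sum_cluster sumr_const card_ord.
  by apply: eq_bigr => t _; case: eqP.
rewrite [in RHS](bigD1 (Tagged (fun l => 'I_(r l)) i))//= {2}/C/= eqxx addrAC subrr add0r.
by apply: eq_bigr => t _; rewrite eq_sym.
Qed.

Lemma gap_score_clusters : gap_score C L = \sum_l score_sum (@lam l).
Proof.
rewrite /gap_score sum_tagged; apply: eq_bigr => l _; apply: eq_bigr => i _.
by rewrite big_mkcond sum_cluster.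
Qed.

Lemma ln_gap_prod_clusters : ln `|gap_prod C L| =
  \sum_l log_sum (@lam l) + \sum_l \sum_l' (r l)%:R * (r l')%:R * ln `|c l - c l'|.
Proof.
rewrite ln_prod_pairs => [|s t]; last by apply: gap_neq0; exact: tagged_separated.
(* Since ln 0 = 0, both logarithms can be written for every pair: the second vanishes inside a
   cluster, and the diagonal adds nothing. *)
transitivity (\sum_s \sum_t ((if C t == C s then ln `|L s - L t| else 0) + ln `|C s - C t|)).
  apply: eq_bigr => s _; rewrite [RHS](bigD1 s)//= eqxx !subrr normr0 ln0// !add0r.
  apply: eq_bigr => t _; rewrite /gap [C t == _]eq_sym; case: eqP => [->|_].
    by rewrite subrr normr0 [ln 0]ln0 ?addr0.
  by rewrite add0r.
rewrite sum_tagged -big_split/=; apply: eq_bigr => l _.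
under eq_bigr do rewrite big_split/= sum_cluster.
rewrite big_split/=; congr (_ + _).
transitivity (\sum_(i < r l) \sum_l' (r l')%:R * ln `|c l - c l'|).
  apply: eq_bigr => i _; rewrite sum_tagged; apply: eq_bigr => l' _.
  by rewrite /C/= sumr_const card_ord mulr_natl.
rewrite sumr_const card_ord -[LHS]mulr_natl mulr_sumr; apply: eq_bigr => l' _.
by rewrite mulrA.
Qed.

End ClusterSums.

(** * Positivity of the score sum, and clusters with a single root *)

Lemma score_sum_gt0 (R : realType) m (x : 'I_m -> R) : (2 <= m)%N -> injective x ->
  0 < score_sum x.
Proof.
move=> m2 ix; rewrite lt0r sumr_ge0 ?andbT => [|i _]; last exact: sqr_ge0.
(* sum_i x_i s_i is half the number of ordered pairs of distinct indices *)
apply/eqP => S0.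
have s0 i : \sum_j (x i - x j)^-1 = 0.
  apply/eqP; rewrite -sqrf_eq0.
  move/eqP: S0; rewrite psumr_eq0 => [/allP/(_ i)|j _]; last exact: sqr_ge0.
  by rewrite mem_index_enum => /(_ isT).
have pairs : \sum_(i : 'I_m) \sum_(j : 'I_m) (j != i)%:R = 0 :> R.
  transitivity (\sum_i \sum_j (x i / (x i - x j) + x j / (x j - x i))).
    apply: eq_bigr => i _; apply: eq_bigr => j _; case: eqVneq => [->|ji].
      by rewrite subrr invr0 !mulr0 addr0.
    have ? : x i - x j != 0 by rewrite subr_eq0 (inj_eq ix) eq_sym.
    have ? : x j - x i != 0 by rewrite subr_eq0 (inj_eq ix).
    by rewrite /=; field; apply/andP.
  under eq_bigr do rewrite big_split/=.
  rewrite big_split/= [X in _ + X]exchange_big/=.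
  by rewrite !big1 ?addr0// => i _; rewrite -mulr_sumr s0 mulr0.
pose i0 := Ordinal (ltnW m2); pose i1 := Ordinal m2.
move/eqP: pairs; apply/negP; rewrite gt_eqF// (bigD1 i0)//= (bigD1 i1)//=.
rewrite -addrA ltr_wpDr ?ltr01// addr_ge0// ?sumr_ge0// => i _.
by rewrite sumr_ge0.
Qed.

Lemma score_sum1 (R : realType) m (x : 'I_m -> R) : (m <= 1)%N -> score_sum x = 0.
Proof.
move=> m1; apply: big1 => i _; rewrite big1 ?expr0n// => j _.
have -> : j = i by apply/val_inj => /=; have := ltn_ord i; have := ltn_ord j; lia.
by rewrite subrr invr0.
Qed.

Lemma log_sum1 (R : realType) m (x : 'I_m -> R) : (m <= 1)%N -> log_sum x = 0.
Proof.
move=> m1; apply: big1 => i _; rewrite big1 // => j _.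
have -> : j = i by apply/val_inj => /=; have := ltn_ord i; have := ltn_ord j; lia.
by rewrite subrr normr0 ln0.
Qed.

(** * Complete factorization of h_e for small nonzero e *)

Section Factorization.
Variable R : realType.

Lemma tangent_poly_roots n (alpha beta u v : 'rV[R]_n) c r :
  (r = 1%N -> root (h_poly alpha beta u v 0) c /\ ~~ root (h_poly alpha beta u v 0)^`() c) ->
  separable_poly (tangent_poly alpha beta u v c r) ->
  exists s : seq R, [/\ size s = r, uniq s,
    tangent_poly alpha beta u v c r = \prod_(x <- s) ('X - x%:P) &
    zooms_to alpha beta u v c r (tangent_poly alpha beta u v c r)].
Proof.
move=> h1 sepQ.
have [sQ mQ [s Qs] zQ] : let Q := tangent_poly alpha beta u v c r in
    [/\ size Q = r.+1, Q \is monic, splits Q & zooms_to alpha beta u v c r Q].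
  have [r1|r1] := eqVneq r 1%N; last exact: tangent_poly_multiple.
  by move: (h1 r1) => []; rewrite r1; exact: tangent_poly_simple.
move: Qs; rewrite (monicP mQ) scale1r => Qs; exists s; split=> //.
  by move: sQ; rewrite Qs size_prod_XsubC => -[].
by rewrite -separable_prod_XsubC -Qs.
Qed.

Lemma monic_prod_roots (T : finType) (x : T -> R) (p : {poly R}) :
  p \is monic -> size p = #|T|.+1 -> injective x -> (forall t, root p (x t)) ->
  p = \prod_t ('X - (x t)%:P).
Proof.
move=> /monicP mp sp ix px.
have := @all_roots_prod_XsubC _ p [seq x t | t : T].
rewrite mp scale1r big_image; apply.
- by rewrite size_image.
- by apply/allP => _ /mapP[t _ ->].
- by rewrite uniq_rootsE map_inj_uniq// enum_uniq.
Qed.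

Lemma h_poly_monic n (alpha beta u v : 'rV[R]_n) e :
  size (h_poly alpha beta u v e) = n.+1 /\ h_poly alpha beta u v e \is monic.
Proof. by apply: fconv_monic; rewrite ?size_root_poly// monic_prod_XsubC. Qed.

(** The selected roots are pairwise distinct for small e and number n in total, so they exhaust the
    roots of the monic h_e. *)
Lemma h_poly_factorization n (alpha beta u v : 'rV[R]_n) kappa (c : 'I_kappa -> R)
    (r : 'I_kappa -> nat) (Q : 'I_kappa -> {poly R}) (lam : forall l, 'I_(r l) -> R) :
  injective c -> (\sum_(l < kappa) r l)%N = n -> (forall l, injective (@lam l)) ->
  (forall l, Q l = \prod_i ('X - (lam l i)%:P)) ->
  (forall l, zooms_to alpha beta u v (c l) (r l) (Q l)) ->
  exists f : {l : 'I_kappa & 'I_(r l)} -> R -> R,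
    (forall t, f t e @[e --> 0^'] --> lam (tag t) (tagged t)) /\
    \forall e \near 0^', h_poly alpha beta u v e = \prod_t ('X - (c (tag t) + e * f t e)%:P).
Proof.
move=> ic rn il QE zQ; set h := h_poly alpha beta u v.
have /choice[f Hf] : forall t : {l : 'I_kappa & 'I_(r l)}, exists f : R -> R,
    (\forall e \near 0^', root (h e) (c (tag t) + e * f e)) /\
    f e @[e --> 0^'] --> lam (tag t) (tagged t).
  by move=> [l i]; exact: (zooms_to_root (il l) (QE l) (zQ l)).
exists f; split=> [t|]; first by have [] := Hf t.
have fL t : f t e @[e --> 0^'] --> lam (tag t) (tagged t) by have [] := Hf t.
have inj := near_injective (tagged_separated ic il) fL.
have rts : \forall e \near 0^', forall t, root (h e) (c (tag t) + e * f t e).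
  by apply: filter_forall => t; have [] := Hf t.
near=> e; have [sh mh] := h_poly_monic alpha beta u v e.
apply: monic_prod_roots => //.
- by rewrite sh card_tagged_ord rn.
- by near: e.
- by near: e.
Unshelve. all: by end_near. Qed.

End Factorization.

(** * Expansions of the entropy, the entropy power and the Fisher information *)

Theorem corollary6p4 (R : realType) (n : nat) (hn : (2 <= n)%N)
    (alpha beta u v : 'rV[R]_n)
    (kappa : nat) (c : 'I_kappa -> R) (r : 'I_kappa -> nat)
    (hc : forall l j : 'I_kappa, (l < j)%N -> c l < c j)
    (hr : forall l : 'I_kappa, (1 <= r l)%N)
    (hrn : (\sum_(l < kappa) r l)%N = n)
    (hh0 : h_poly alpha beta u v 0
           = \prod_(l < kappa) ('X - (c l)%:P) ^+ r l)
    (hQ : forall l : 'I_kappa,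
        separable_poly (tangent_poly alpha beta u v (c l) (r l))) :
  let h := h_poly alpha beta u v in
  let Q := fun l : 'I_kappa => tangent_poly alpha beta u v (c l) (r l) in
  let nn1 : R := n%:R * (n%:R - 1) in
  let M : R := \sum_(l < kappa) (r l)%:R * ((r l)%:R - 1) in
  let Dstar : R :=
    (\prod_(l < kappa) disc (r l) (Q l))
    * \prod_(l < kappa) \prod_(j < kappa | (l < j)%N)
        `|c l - c j| ^+ (2 * r l * r j) in
  let theta : R := M / nn1 in
  let K : R :=
    4 / (n%:R * (n%:R - 1) ^+ 2)
    * \sum_(l < kappa) sqnorm2 (score (root_vec (r l) (Q l))) in
  [/\ (* asymptotics of the entropy and of the entropy power *)
      (exists2 g : R -> R,
          g =O_ (0^') (fun e : R => `|e|) &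
          \forall e \near 0^',
            entropy n (h e) = (theta * ln `|e| + ln Dstar / nn1 + g e)%:E)
      /\ (exists2 g : R -> R,
          g =O_ (0^') (fun e : R => `|e|) &
          \forall e \near 0^',
            entropy_power n (h e)
            = (`|e| `^ (2 * theta) * Dstar `^ (2 / nn1) * (1 + g e))%:E),
      (* analytic extensions *)
      (exists F : R -> R,
          analytic_extension0
            (fun e => entropy n (h e) - (theta * ln `|e|)%:E)%E F)
      /\ (exists F : R -> R,
          analytic_extension0
            (fun e => (`|e| `^ (- (2 * theta)))%:E * entropy_power n (h e))%E
            F),
      (* the constant term of the entropy *)
      (ln Dstar / nn1)%:E
      = (\sum_(l < kappa | (2 <= r l)%N)
            ((r l)%:R * ((r l)%:R - 1) / nn1)%R%:E * entropy (r l) (Q l)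
         + (2 / nn1 * \sum_(l < kappa) \sum_(j < kappa | (l < j)%N)
              (r l)%:R * (r j)%:R * ln `|c l - c j|)%R%:E)%E,
      (* the Fisher information *)
      (exists2 F : R -> R,
          analytic_extension0
            (fun e => (e ^+ 2)%:E * fisher n (h e))%E F &
          F 0 = K)
      /\ K%:E
         = (\sum_(l < kappa | (2 <= r l)%N)
              ((r l)%:R * ((r l)%:R - 1) ^+ 2 / (n%:R * (n%:R - 1) ^+ 2))%R%:E
              * fisher (r l) (Q l))%E
    & (exists l : 'I_kappa, (2 <= r l)%N) ->
      [/\ 0 < K,
          (exists2 g : R -> R,
              g =O_ (0^') (fun e : R => `|e|^-1) &
              \forall e \near 0^',
                fisher n (h e) = (K * (e ^+ 2)^-1 + g e)%:E)
        & (exists2 g : R -> R,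
              g =O_ (0^') (fun e : R => `|e| ^+ 3) &
              \forall e \near 0^',
                (fisher n (h e))^-1%E = (K^-1 * e ^+ 2 + g e)%:E)]].
Proof.
move=> h Q nn1 M Dstar theta K.
have ic : injective c.
  move=> l j clj; apply/val_inj; case: (ltngtP l j) => // /hc; by rewrite clj ltxx.
have simple l : r l = 1%N -> root (h 0) (c l) /\ ~~ root (h 0)^`() (c l).
  move=> rl; rewrite /h hh0 (bigD1 l)//= rl expr1; split.
    by rewrite rootM root_XsubC eqxx.
  rewrite derivM derivXsubC mul1r /root hornerD hornerM hornerXsubC subrr mul0r addr0.
  rewrite horner_prod; apply/prodf_neq0 => j jl.
  by rewrite horner_exp hornerXsubC expf_neq0// subr_eq0 (inj_eq ic) eq_sym.
have /choice[s Hs] : forall l, exists s : seq R, [/\ size s = r l, uniq s,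
    Q l = \prod_(x <- s) ('X - x%:P) & zooms_to alpha beta u v (c l) (r l) (Q l)].
  by move=> l; apply: tangent_poly_roots (hQ l); exact: simple.
pose lam l (i : 'I_(r l)) := nth 0 (s l) i.
have il l : injective (lam l).
  move=> i j /eqP; have [sl us _ _] := Hs l.
  by rewrite nth_uniq ?sl// => /eqP/val_inj.
have QE l : Q l = \prod_i ('X - (lam l i)%:P).
  have [sl us -> _] := Hs l; rewrite (big_nth 0) sl big_mkord.
  by [].
have zQ l : zooms_to alpha beta u v (c l) (r l) (Q l) by have [] := Hs l.
have [f [fL hf]] := h_poly_factorization ic hrn il QE zQ.
pose C (t : {l : 'I_kappa & 'I_(r l)}) := c (tag t).
pose L (t : {l : 'I_kappa & 'I_(r l)}) := lam _ (tagged t).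
have cT : #|{: {l : 'I_kappa & 'I_(r l)}}| = n by rewrite card_tagged_ord.
have n1 : n = n.-1.+1 by rewrite prednK// ltnW.
have cT1 : #|{: {l : 'I_kappa & 'I_(r l)}}| = n.-1.+1 by rewrite cT.
have [G [N [G0 GE NG HGN]]] := cluster_expansion (tagged_separated ic il) fL cT1
  (polyfam_h_poly alpha beta u v) hf.
have countM : (gap_count C)%:R = M by exact: gap_count_clusters.
have scoreK : K = 4 / (n%:R * (n%:R - 1) ^+ 2) * gap_score C L.
  congr (_ * _); rewrite gap_score_clusters//; apply: eq_bigr => l _.
  by rewrite (sqnorm2_score_roots (card_ord _) (QE l)).
have discQ l : 0 < disc (r l) (Q l) /\ ln (disc (r l) (Q l)) = log_sum (lam l).
  exact: disc_roots (card_ord _) (il l) (QE l).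
have cc0 (l j : 'I_kappa) : (l < j)%N -> 0 < `|c l - c j|.
  by move=> /hc lj; rewrite normr_gt0 subr_eq0 lt_eqF.
have lnD : ln Dstar = \sum_l log_sum (lam l) +
    \sum_(l < kappa) \sum_(j < kappa | (l < j)%N) 2 * ((r l)%:R * (r j)%:R * ln `|c l - c j|).
  rewrite /Dstar lnM ?posrE ?prodr_gt0// => [|l _|l _]; last 2 first.
  - exact: (discQ l).1.
  - by apply: prodr_gt0 => j lj; rewrite exprn_gt0// cc0.
  congr (_ + _).
    by rewrite ln_prodr => [|l _]; [apply: eq_bigr => l _; exact: (discQ l).2|exact: (discQ l).1].
  rewrite ln_prodr => [|l _]; last by apply: prodr_gt0 => j lj; rewrite exprn_gt0// cc0.
  apply: eq_bigr => l _; rewrite ln_prodr => [|j lj]; last by rewrite exprn_gt0// cc0.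
  apply: eq_bigr => j lj; rewrite lnXn ?cc0// -[LHS]mulr_natl !natrM; ring.
have D0 : 0 < Dstar.
  rewrite mulr_gt0 ?prodr_gt0// => l _; first exact: (discQ l).1.
  by apply: prodr_gt0 => j lj; rewrite exprn_gt0// cc0.
(* The logarithm of [gap_prod] counts ordered pairs of clusters, while D_* takes l < j with exponent
   2 r_l r_j; [sum_lt_pairs] reconciles the two. *)
have lnG : ln G.[0] = ln Dstar.
  rewrite GE lnD (ln_gap_prod_clusters ic il); congr (_ + _).
  rewrite -sum_lt_pairs => [|l|l j].
  - by rewrite mulr_sumr; apply: eq_bigr => l _; rewrite mulr_sumr.
  - by rewrite subrr normr0 ln0// mulr0.
  - by rewrite distrC; ring.
have nn0 : nn1 != 0.
  by rewrite mulf_neq0 ?subr_eq0 ?pnatr_eq0 ?(eqr_nat R n 1) //; move: hn; case: (n) => [|[]].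
have Hent : \forall e \near 0^',
    entropy n (h e) = (theta * ln `|e| + nn1^-1 * ln G.[e])%:E.
  near=> e; have [ix lx _] : [/\ injective (fun t => C t + e * f t e),
      log_sum (fun t => C t + e * f t e) = (gap_count C)%:R * ln `|e| + ln G.[e] &
      e ^+ 2 * score_sum (fun t => C t + e * f t e) = N.[e] / (G ^+ 2).[e]] by near: e.
  have he : h e = \prod_t ('X - (C t + e * f t e)%:P) by near: e.
  rewrite (entropy_roots cT ix he) lx countM; congr EFin; rewrite /theta -/nn1.
  by field.
pose F e := 4 / (n%:R * (n%:R - 1) ^+ 2) * (N.[e] / (G ^+ 2).[e]).
have Hfis : \forall e \near 0^', fisher n (h e) = (F e / e ^+ 2)%:E.
  near=> e; have e0 : e != 0 by near: e; exact: nbhs_dnbhs_neq.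
  have [ix _ sx] : [/\ injective (fun t => C t + e * f t e),
      log_sum (fun t => C t + e * f t e) = (gap_count C)%:R * ln `|e| + ln G.[e] &
      e ^+ 2 * score_sum (fun t => C t + e * f t e) = N.[e] / (G ^+ 2).[e]] by near: e.
  have he : h e = \prod_t ('X - (C t + e * f t e)%:P) by near: e.
  rewrite (fisher_roots cT ix he) /F -sx; congr EFin.
  by rewrite [in RHS]mulrCA [RHS]mulrC mulKf// expf_neq0.
have [an1 O1] := analytic_ln nn1^-1 G0.
have [an2 O2] := analytic_exp_ln (2 / nn1) G0.
have G20 : (G ^+ 2).[0] != 0 by rewrite horner_exp expf_neq0// gt_eqF.
have [an3 O3] := analytic_div N (4 / (n%:R * (n%:R - 1) ^+ 2)) G20.
(* The value of the quotient at 0 is K, so [O3] becomes F e - K = O(|e|) for the F above. *)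
rewrite NG -scoreK in O3.
have powE (x a : R) : 0 < x -> x `^ a = expR (a * ln x) by move=> x0; rewrite /powR gt_eqF.
have Hpow : \forall e \near 0^', entropy_power n (h e) =
    (`|e| `^ (2 * theta) * expR (2 / nn1 * ln G.[e]))%:E.
  near=> e; have e0 : e != 0 by near: e; exact: nbhs_dnbhs_neq.
  have -> : entropy_power n (h e) = expeR (2%:E * (theta * ln `|e| + nn1^-1 * ln G.[e])%:E)%E.
    by rewrite /entropy_power; congr (expeR (_ * _)%E); near: e.
  by rewrite -EFinM/= powE ?normr_gt0// -expRD; congr (expR _)%:E; ring.
have scale l : (2 <= r l)%N -> (r l)%:R * ((r l)%:R - 1) != 0 :> R.
  by move=> rl; rewrite mulf_neq0 ?subr_eq0 ?pnatr_eq0 ?(eqr_nat R _ 1)//; move: rl; case: (r l) => [|[]].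
have n0 : n%:R != 0 :> R by rewrite pnatr_eq0; case: (n) hn.
have nm0 : n%:R - 1 != 0 :> R by rewrite subr_eq0 (eqr_nat R _ 1); case: (n) hn => [|[]].
split.
- split.
    exists (fun e => nn1^-1 * ln G.[e] - nn1^-1 * ln G.[0]); first exact: O1.
    apply: filterS Hent => e ->; congr EFin; rewrite lnG; ring.
  exists (fun e => (expR (2 / nn1 * ln G.[e]) - expR (2 / nn1 * ln G.[0])) / Dstar `^ (2 / nn1)).
    move/eqO_exP: O2 => [k k0 O2]; apply/eqO_exP.
    exists (k / Dstar `^ (2 / nn1)); first by rewrite divr_gt0// powR_gt0.
    apply: filterS O2 => e O2; rewrite normrM normfV [`|_ `^ _|]gtr0_norm ?powR_gt0//.
    by rewrite [leRHS]mulrAC ler_pM2r// invr_gt0 powR_gt0.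
  apply: filterS Hpow => e ->; congr EFin; rewrite lnG -(powE _ _ D0).
  by field; rewrite gt_eqF// powR_gt0.
- split.
    exists (fun e => nn1^-1 * ln G.[e]); split; first exact: an1.
    by apply: filterS Hent => e ->; rewrite -EFinB addrC addKr.
  exists (fun e => expR (2 / nn1 * ln G.[e])); split; first exact: an2.
  near=> e; have e0 : e != 0 by near: e; exact: nbhs_dnbhs_neq.
  have -> : entropy_power n (h e) = (`|e| `^ (2 * theta) * expR (2 / nn1 * ln G.[e]))%:E by near: e.
  by rewrite -EFinM mulrA -powRD ?addNr ?powRr0 ?mul1r// normr_eq0 e0 implybT.
- have -> : (\sum_(l < kappa | (2 <= r l)%N)
      ((r l)%:R * ((r l)%:R - 1) / nn1)%R%:E * entropy (r l) (Q l))%E =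
      (\sum_(l < kappa | (2 <= r l)%N) log_sum (lam l) / nn1)%:E.
    rewrite -sumEFin; apply: eq_bigr => l rl.
    rewrite (entropy_roots (card_ord _) (il l) (QE l)) -EFinM; congr EFin.
    by have := scale l rl; rewrite mulf_eq0 negb_or => /andP[? ?]; field; do !(apply/andP; split).
  rewrite -EFinD; congr EFin; rewrite lnD mulrDl; congr (_ + _).
    (* Clusters with one root have [log_sum] 0, so restricting to r_l >= 2 does not change the
       sum. *)
    rewrite mulr_suml [RHS]big_mkcond; apply: eq_bigr => l _.
    by case: leqP => // rl; rewrite log_sum1 ?mul0r.
  rewrite mulr_suml mulr_sumr; apply: eq_bigr => l _.
  rewrite mulr_suml mulr_sumr; apply: eq_bigr => j _; ring.
- split.
    exists F; last by rewrite /F NG scoreK.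
    split; first exact: an3.
    near=> e; have e0 : e != 0 by near: e; exact: nbhs_dnbhs_neq.
    have -> : fisher n (h e) = (F e / e ^+ 2)%:E by near: e.
    by rewrite -EFinM mulrC divfK// expf_neq0.
  have -> : (\sum_(l < kappa | (2 <= r l)%N)
      ((r l)%:R * ((r l)%:R - 1) ^+ 2 / (n%:R * (n%:R - 1) ^+ 2))%R%:E * fisher (r l) (Q l))%E =
      (\sum_(l < kappa | (2 <= r l)%N) 4 / (n%:R * (n%:R - 1) ^+ 2) * score_sum (lam l))%:E.
    rewrite -sumEFin; apply: eq_bigr => l rl.
    rewrite (fisher_roots (card_ord _) (il l) (QE l)) -EFinM; congr EFin.
    by have := scale l rl; rewrite mulf_eq0 negb_or => /andP[? ?]; field; do !(apply/andP; split).
  congr EFin; rewrite scoreK gap_score_clusters// mulr_sumr [RHS]big_mkcond.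
  by apply: eq_bigr => l _; case: leqP => // rl; rewrite score_sum1 ?mulr0.
case=> l0 rl0.
have K0 : 0 < K.
  rewrite scoreK gap_score_clusters// mulr_gt0//.
    by rewrite divr_gt0// mulr_gt0 ?exprn_even_gt0// lt0r n0 ler0n.
  rewrite (bigD1 l0)//= ltr_pwDl ?score_sum_gt0 ?sumr_ge0// => l _.
  by apply: sumr_ge0 => i _; exact: sqr_ge0.
move/eqO_exP: O3 => [k k0 O3].
(* Staying above K/2 keeps 1/F bounded; |e| <= K/(2k) is enough because |F e - K| <= k |e|. *)
have FK2 : \forall e \near 0^', K / 2 <= F e.
  near=> e; have FK : `|F e - K| <= k * `| `|e| | by near: e.
  have : `|e| <= K / (2 * k) by near: e; apply: dnbhs0_le; rewrite divr_gt0// mulr_gt0.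
  rewrite ler_pdivlMr ?mulr_gt0// => H; move: FK; rewrite normr_id ler_norml => /andP[+ _].
  lra.
split=> //.
  exists (fun e => (F e - K) / e ^+ 2).
    apply/eqO_exP; exists k => //; near=> e.
    have e0 : e != 0 by near: e; exact: nbhs_dnbhs_neq.
    have : `|F e - K| <= k * `| `|e| | by near: e.
    rewrite !normr_id normrM normfV normrX => H.
    rewrite normfV normr_id ler_pdivrMr ?exprn_gt0 ?normr_gt0//.
    by rewrite expr2 -mulrA mulKf ?normr_eq0.
  apply: filterS Hfis => e ->; congr EFin; ring.
exists (fun e => e ^+ 2 / F e - e ^+ 2 / K).
  (* The remainder is - e^2 (F e - K)/(F e K); the numerator is at most k |e|^3 in absolute value
     and F e >= K/2 in the denominator. *)
  apply/eqO_exP; exists (k / (K / 2 * K)).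
    by rewrite divr_gt0// mulr_gt0// divr_gt0.
  near=> e; have e0 : e != 0 by near: e; exact: nbhs_dnbhs_neq.
  have FK : `|F e - K| <= k * `| `|e| | by near: e.
  have FK2e : K / 2 <= F e by near: e.
  have Fe0 : 0 < F e by apply: lt_le_trans FK2e; rewrite divr_gt0.
  have -> : e ^+ 2 / F e - e ^+ 2 / K = - (e ^+ 2 * (F e - K)) / (F e * K).
    by field; rewrite !gt_eqF.
  rewrite normrM normfV normrN normrM !normrX !normr_id [`|F e * K|](gtr0_norm (mulr_gt0 Fe0 K0)).
  rewrite (ler_pdivrMr _ _ (mulr_gt0 Fe0 K0)).
  apply: (@le_trans _ _ (`|e| ^+ 2 * (k * `|e|))).
    by rewrite ler_wpM2l ?exprn_ge0//; move: FK; rewrite normr_id.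
  have -> : k / (K / 2 * K) * `|e| ^+ 3 * (F e * K) = `|e| ^+ 2 * (k * `|e|) * (F e / (K / 2)).
    by field; rewrite gt_eqF.
  rewrite ler_peMr ?mulr_ge0 ?exprn_ge0 ?(ltW k0)//.
  by rewrite ler_pdivlMr ?mul1r// divr_gt0.
near=> e; have e0 : e != 0 by near: e; exact: nbhs_dnbhs_neq.
have -> : fisher n (h e) = (F e / e ^+ 2)%:E by near: e.
have FK2e : K / 2 <= F e by near: e.
have Fe0 : F e != 0 by rewrite gt_eqF// (lt_le_trans _ FK2e)// divr_gt0.
(* F e / e^2 is nonzero, so the inverse in the extended reals is the real inverse. *)
rewrite inver mulf_eq0 (negPf Fe0) invr_eq0 expf_eq0/= (negPf e0)/=.
by congr EFin; rewrite invfM invrK; ring.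
Unshelve. all: by end_near. Qed.
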